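(* Assume (H1), (H2), (H3) (spelled out in the context) and that $(X_k)_{k\ge 1}$ has policy $(q_k)_{k\ge 0}$ with $q_k=(1-\lambda_k)f_k+\lambda_k q_0$ for all $k\ge 1$, where $f_k$ is the weighted kernel estimate built from $X_1,\dots,X_k$. If there exists $\epsilon>0$ such that $a_n+h_n^4\ll \lambda_n^{1+\epsilon}\ll 1$, then with probability $1$ $$\sup_{x\in\mathbb R^d}|f_n(x)-f(x)|=O(a_n+h_n^2).$$
   Context: Let $f_U:\mathbb R^d\to[0,\infty)$ be measurable with $0<\int f_U<\infty$ (all integrals are with respect to Lebesgue measure), and $f=f_U/\int f_U$. Let $(X_k)_{k\ge1}$ be $\mathbb R^d$-valued random variables, $\mathcal F_k=\sigma(X_1,\dots,X_k)$ for $k\ge 1$, $\mathcal F_0$ trivial. A policy of $(X_k)_{k\ge 1}$ is a sequence $(q_k)_{k\ge0}$ of (random) probability densities on $\mathbb R^d$, adapted to $(\mathcal F_k)_{k\ge0}$, such that conditionally on $\mathcal F_{k-1}$, $X_k$ has density $q_{k-1}$, for all $k\ge1$. The density $q_0$ is deterministic. Importance weights: $W_k=f_U(X_k)/q_{k-1}(X_k)$; normalized weights: $W_{n,k}=W_k/\sum_{j=1}^nW_j$, $k=1,\dots,n$. Kernel estimate: $f_n(x)=\sum_{k=1}^nW_{n,k}K_{h_n}(x-X_k)$, where $K_h(u)=K(u/h)/h^d$. Sequences (deterministic): $(h_k)_{k\ge1}$ is positive and bounded; $(\lambda_k)_{k\ge1}\subset(0,1]$ is nonincreasing; $a_n=\sqrt{\log(n)/(nh_n^d)}$.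 For nonnegative sequences, $u_n\ll v_n$ means $u_n/v_n\to0$; $u_n=O(v_n)$ means $u_n/v_n$ is bounded (for large $n$). Assumptions: (H1) $f$ is a probability density on $\mathbb R^d$, twice continuously differentiable with bounded second derivatives. (H2) $q_0$ is a probability density on $\mathbb R^d$; for every $\eta\in(0,1]$ there is $c_\eta>0$ with $f(x)^\eta\le c_\eta q_0(x)$ for all $x\in\mathbb R^d$; and there are $C_0,r_0>0$ with $q_0(x)\le C_0(1+\|x\|)^{-r_0}$ for all $x$. (H3) $K:\mathbb R^d\to[0,\infty)$ is a Lipschitz probability density with $\int uK(u)\,du=0$, $\int\|u\|^2K(u)\,du<\infty$, and there are $C_K,r_K>0$ with $K(x)\le C_K(1+\|x\|)^{-r_K}$ for all $x$. *)

(* Defs.v *)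
From HB Require Import structures.
From mathcomp Require Import all_boot all_order all_algebra.
From mathcomp Require Import all_classical all_reals all_analysis.
Set Implicit Arguments.
Unset Strict Implicit.
Unset Printing Implicit Defensive.
Import Order.TTheory GRing.Theory Num.Theory.
Import numFieldNormedType.Exports.
Local Open Scope classical_set_scope.
Local Open Scope ring_scope.

(* R^d is ['rV[R]_d], with the sigma-algebra generated by the coordinates, i.e.
   the Borel sigma-algebra (the library puts no measurable structure on
   matrices). *)
Definition rV_display : measure_display.
Proof. exact: default_measure_display. Qed.

Section measurable_rV.
Context {R : realType} {n : nat}.

Let coord (i : 'I_n) (v : 'rV[R]_n) : measurableTypeR R := v ord0 i.

Let rV_set0 : g_sigma_preimage coord set0.
Proof. exact: sigma_algebra0. Qed.

Let rV_setC A : g_sigma_preimage coord A -> g_sigma_preimage coord (~` A).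
Proof. exact: sigma_algebraC. Qed.

Let rV_bigcup (F : (set 'rV[R]_n)^nat) :
  (forall i, g_sigma_preimage coord (F i)) ->
  g_sigma_preimage coord (\bigcup_i F i).
Proof. exact: sigma_algebra_bigcup. Qed.

HB.instance Definition _ := @isMeasurable.Build rV_display
  'rV[R]_n (g_sigma_preimage coord) rV_set0 rV_setC rV_bigcup.

End measurable_rV.

Section lebesgue_rV.
Context {R : realType}.

Lemma measurable_coord n (i : 'I_n) :
  measurable_fun [set: 'rV[R]_n] (fun v => v ord0 i : measurableTypeR R).
Proof.
move=> _ Y mY; rewrite setTI; apply: sub_sigma_algebra => /=.
rewrite -bigcup_seq/=; exists i => /=; first by rewrite mem_index_enum.
by exists Y => //; rewrite setTI.
Qed.

Lemma measurable_fun_rV d (T : measurableType d) n (f : T -> 'rV[R]_n) :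
  (forall i, measurable_fun setT (fun t => f t ord0 i : measurableTypeR R)) ->
  measurable_fun setT f.
Proof.
move=> mf _ A mA; rewrite setTI.
suff : image_set_system setT f measurable A.
  by rewrite /image_set_system/= setTI.
move: A mA; apply: smallest_sub.
  exact/sigma_algebra_image/sigma_algebra_measurable.
move=> A; rewrite -bigcup_seq/= => -[i /= _ [B mB <-]].
rewrite /image_set_system/= !setTI.
by have := mf i measurableT B mB; rewrite setTI.
Qed.

Definition rV_cons n (p : measurableTypeR R * 'rV[R]_n) : 'rV[R]_n.+1 :=
  row_mx (p.1)%:M p.2.

Lemma rV_consE n (p : measurableTypeR R * 'rV[R]_n) (i : 'I_n.+1) :
  rV_cons p ord0 i = if unlift ord0 i is Some j then p.2 ord0 j else p.1.
Proof.
rewrite /rV_cons; case: unliftP => [j ->|->].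
  have -> : lift ord0 j = rshift 1 j :> 'I_(1 + n) by apply/val_inj.
  exact: row_mxEr.
have -> : ord0 = lshift n ord0 :> 'I_(1 + n) by apply/val_inj.
by rewrite (row_mxEl (p.1)%:M p.2) mxE eqxx.
Qed.

Lemma measurable_rV_cons n : measurable_fun setT (@rV_cons n).
Proof.
apply: measurable_fun_rV => i; under eq_fun do rewrite rV_consE.
case: (unlift _ _) => [j|]; last exact: measurable_fst.
exact: (measurableT_comp (measurable_coord j) measurable_snd).
Qed.

Section step.
Context n (mu : {sigma_finite_measure set 'rV[R]_n -> \bar R}).

Definition lebesgue_rV_step : set 'rV[R]_n.+1 -> \bar R :=
  pushforward ((@lebesgue_measure R) \x mu)%E (@rV_cons n).

Let lebesgue_rV_step0 : lebesgue_rV_step set0 = 0%E.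
Proof. by rewrite /lebesgue_rV_step /pushforward preimage_set0 measure0. Qed.

Let lebesgue_rV_step_ge0 A : (0 <= lebesgue_rV_step A)%E.
Proof. by rewrite /lebesgue_rV_step /pushforward measure_ge0. Qed.

Let lebesgue_rV_step_sigma_additive : semi_sigma_additive lebesgue_rV_step.
Proof.
have mf := @measurable_rV_cons n.
rewrite /lebesgue_rV_step; exact: measure_semi_sigma_additive.
Qed.

HB.instance Definition _ := isMeasure.Build _ _ _ lebesgue_rV_step
  lebesgue_rV_step0 lebesgue_rV_step_ge0 lebesgue_rV_step_sigma_additive.

Definition rV_uncons (v : 'rV[R]_n.+1) : measurableTypeR R * 'rV[R]_n :=
  (v ord0 ord0, \row_j v ord0 (lift ord0 j)).

Lemma rV_consK : cancel (@rV_cons n) rV_uncons.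
Proof.
move=> [x v]; rewrite /rV_uncons rV_consE unlift_none/=; congr pair.
by apply/rowP => j; rewrite mxE rV_consE liftK.
Qed.

Lemma measurable_rV_uncons : measurable_fun setT rV_uncons.
Proof.
apply: measurable_fun_pair; first exact: measurable_coord.
apply: measurable_fun_rV => i; under eq_fun do rewrite mxE.
exact: measurable_coord.
Qed.

Lemma lebesgue_rV_step_sigma_finite : sigma_finite setT lebesgue_rV_step.
Proof.
have [F FT Foo] : sigma_finite setT ((@lebesgue_measure R) \x mu)%E.
  have /sigma_finiteP[F [TF ndF Foo]] := sigma_finiteT (@lebesgue_measure R).
  have /sigma_finiteP[G [TG ndG Goo]] := sigma_finiteT mu.
  exists (fun i => F i `*` G i).
    rewrite -setXTT TF TG; apply/seteqP; split => -[x y] /=.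
      move=> [[i _ Fx] [j _ Gy]]; exists (maxn i j) => //; split.
        by move: x Fx; exact/subsetPset/ndF/leq_maxl.
      by move: y Gy; exact/subsetPset/ndG/leq_maxr.
    by move=> [i _ [/= Fx Gy]]; split; exists i.
  move=> i; have [? ?] := Foo i; have [? ?] := Goo i.
  split; first exact: measurableX.
  by rewrite product_measure1E// lte_mul_pinfty// ge0_fin_numE.
exists (fun i => rV_uncons @^-1` F i).
  by rewrite -preimage_bigcup -FT preimage_setT.
move=> i; have [mF Fi] := Foo i; split.
  by rewrite -[X in measurable X]setTI; exact: measurable_rV_uncons.
rewrite /lebesgue_rV_step /pushforward -comp_preimage.
by rewrite (_ : rV_uncons \o _ = id)//; apply/funext => p /=; rewrite rV_consK.
Qed.

HB.instance Definition _ := Measure_isSigmaFinite.Build _ _ _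
  lebesgue_rV_step lebesgue_rV_step_sigma_finite.

End step.

(* Lebesgue measure on R^n, as the n-fold product of the one-dimensional one;
   [lebesgue_rV_box] below characterizes it. *)
Fixpoint lebesgue_rV (n : nat) : {sigma_finite_measure set 'rV[R]_n -> \bar R} :=
  if n is n'.+1 then lebesgue_rV_step (lebesgue_rV n') else \d_(0 : 'rV[R]_0).

Lemma lebesgue_rV_box n (A : 'I_n -> set R) :
  (forall i, measurable (A i : set (measurableTypeR R))) ->
  lebesgue_rV n [set v | forall i, A i (v ord0 i)] =
  (\prod_(i < n) lebesgue_measure (A i))%E.
Proof.
elim: n A => [|n IH] A mA.
  rewrite big_ord0 /= diracE mem_set//= => i; by case: i.
have mB : measurable [set v : 'rV[R]_n | forall i, A (lift ord0 i) (v ord0 i)].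
  rewrite (_ : [set _ | _] = \big[setI/setT]_(i < n)
    ((fun v : 'rV[R]_n => v ord0 i : measurableTypeR R) @^-1` A (lift ord0 i))).
    apply: bigsetI_measurable => i _.
    by rewrite -[X in measurable X]setTI; exact: measurable_coord.
  rewrite -bigcap_seq; apply/seteqP; split => v /= Hv i; last first.
    by apply: Hv => /=; rewrite mem_index_enum.
  by move=> _; exact: Hv.
rewrite big_ord_recl -IH//= /lebesgue_rV_step /pushforward.
rewrite -product_measure1E//; congr (_ _).
apply/seteqP; split => -[x v] /= H.
  split; first by have := H ord0; rewrite rV_consE unlift_none.
  by move=> i; have := H (lift ord0 i); rewrite rV_consE liftK.
by move=> i; rewrite rV_consE; case: unliftP => [j ->|->]; case: H => // _; exact.
Qed.

End lebesgue_rV.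

Section densities.
Context {R : realType} {d : nat}.
Implicit Types (f K : 'rV[R]_d -> R) (x u : 'rV[R]_d).

(* The Euclidean norm; the library's norm on ['rV[R]_d] is the sup norm. *)
Definition enorm x : R := Num.sqrt (\sum_(i < d) x ord0 i ^+ 2).

Definition is_density f : Prop :=
  [/\ measurable_fun setT f, forall x, 0 <= f x &
      (\int[lebesgue_rV d]_x (f x)%:E = 1)%E].

Definition normalize f x : R := f x / fine (\int[lebesgue_rV d]_y (f y)%:E)%E.

Definition gradient f x : 'rV[R]_d := \row_i 'D_(delta_mx ord0 i) f x.

Definition hessian f x : 'M[R]_d := 'J (gradient f) x.

Definition C2 f : Prop :=
  [/\ forall x, differentiable f x, forall x, differentiable (gradient f) x &
      continuous (hessian f)].

Definition polynomial_decay f : Prop :=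
  exists C r : R, [/\ 0 < C, 0 < r &
    forall x, f x <= C * (1 + enorm x) `^ (- r)].

Definition target_hyp f : Prop :=
  [/\ is_density f, C2 f &
      exists M : R, forall x i j, `|hessian f x i j| <= M].

Definition safe_density_hyp f (q0 : 'rV[R]_d -> R) : Prop :=
  [/\ is_density q0,
      forall eta : R, 0 < eta <= 1 ->
        exists2 c : R, 0 < c & forall x, f x `^ eta <= c * q0 x &
      polynomial_decay q0].

Definition kernel_hyp K : Prop :=
  [/\ is_density K,
      exists L : R, forall x y, `|K x - K y| <= L * enorm (x - y),
      forall i, (\int[lebesgue_rV d]_u (u ord0 i * K u)%:E = 0)%E,
      (\int[lebesgue_rV d]_u (enorm u ^+ 2 * K u)%:E < +oo)%E &
      polynomial_decay K].

End densities.

Section sampling.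
Context {R : realType} {d : nat} {dO : measure_display}
  {Omega : measurableType dO} {P : probability Omega R}.
Variable X : nat -> {RV P >-> 'rV[R]_d}.
Variable q : nat -> Omega -> 'rV[R]_d -> R.

(* Samples are numbered from 1: [X 0] is never used. *)
Definition history k : set (set Omega) :=
  g_sigma_preimage (fun i : 'I_k => X i.+1 : Omega -> 'rV[R]_d).

(* The last condition says that, given [history k], [X k.+1] has density
   [q k]. Adaptedness of [q k] is joint measurability in [(w, x)] with respect to
   [history k] and the Borel sets of R^d. *)
Definition is_policy : Prop :=
  [/\ forall k w, is_density (q k w),
      forall k, measurable_fun
        [set: g_sigma_algebraType (history k) * 'rV[R]_d]
        (fun p => q k p.1 p.2) &
      forall k A B, history k A -> measurable B ->
        P (A `&` X k.+1 @^-1` B) =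
        (\int[P]_(w in A) \int[lebesgue_rV d]_(x in B) (q k w x)%:E)%E].

Variables (fU K : 'rV[R]_d -> R) (h : nat -> R).

(* A null value of the denominator has probability zero. *)
Definition weight k w : R := fU (X k w) / q k.-1 w (X k w).

(* When the first [n] weights all vanish the quotient is 0/0; the weights are
   then taken uniform, so that [wkde n] is a probability density in all cases. *)
Definition nweight n k w : R :=
  let S := \sum_(1 <= j < n.+1) weight j w in
  if S == 0 then n%:R^-1 else weight k w / S.

Definition scaled_kernel (b : R) (u : 'rV[R]_d) : R := K (b^-1 *: u) / b ^+ d.

Definition wkde n w (x : 'rV[R]_d) : R :=
  \sum_(1 <= k < n.+1) nweight n k w * scaled_kernel (h n) (x - X k w).

End sampling.

Definition negligible_wrt (R : realType) (u v : nat -> R) : Prop :=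
  (fun n => u n / v n) @ \oo --> (0 : R).

Definition rate (R : realType) (d : nat) (h : nat -> R) (n : nat) : R :=
  Num.sqrt (ln n%:R / (n%:R * h n ^+ d)).

(* Main.v *)
(* The weights make [w_k phi(X_k)], [w_k = f(X_k) / q_(k-1)(X_k)], conditionally
   unbiased for the integral of [f phi], with conditional second moment the
   integral of [f^2 phi^2 / q_(k-1)]. An exponential supermartingale bounds the
   deviation of the weighted sums on the event that their quadratic variation is
   at most [v]. Apply this to [phi = 1] and to [phi = K_h(x - .)], [x] in a
   polynomially fine grid of a polynomially large box, and conclude by
   Borel-Cantelli; between grid points the kernel is Lipschitz, outside the box
   everything is tiny because [f], [q0] and [K] decay. So if the mean of
   [f^2 / q_k] over [k < n] is [O(rho_n u)] for a bounded integrable [u], then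
   [sup |f_n - f| = O(a_n sqrt(rho_n) + h_n^2)].

   This is used twice, with [u = f + f^eta] and [eta = eps / (1 + eps)]. The
   safe component [lambda_k q0] alone allows [rho_n = 1 / lambda_n], and the
   resulting error is [o(lambda_n^((1 + eps) / 2))]. Hence [q_k >= f / 4] where
   [f] exceeds this error, while elsewhere
   [f^2 / q_k <= c_eta f^(2 - eta) / lambda_k <= c_eta f^eta]. This allows
   [rho_n = 1]. *)
Require Import Defs.
From HB Require Import structures.
From mathcomp Require Import all_boot all_order all_algebra.
From mathcomp Require Import all_classical all_reals all_analysis.
From mathcomp Require Import measurable_realfun.
From mathcomp Require Import ring lra zify.
Set Implicit Arguments.
Unset Strict Implicit.
Unset Printing Implicit Defensive.
Import Order.TTheory GRing.Theory Num.Theory.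
Import numFieldNormedType.Exports.
Local Open Scope classical_set_scope.
Local Open Scope ring_scope.

(** * Change of variables *)

(** The obstacle is a circularity: [q_k] is built from the estimate [f_k], whose accuracy depends on
    the earlier [q_j], so no good variance bound is known in advance. The tail bound therefore uses
    a deterministic level [v_n] and puts the condition on the quadratic variation inside the event.
    The condition is then checked path by path, from a random index on, and the conclusion of the
    first pass is what verifies it for the second. The assumption on the rates enters at two points.
    Weights are only bounded by [c / lambda_n], so the exponential bound needs [a_n / lambda_n] to
    tend to 0. The crude error [a_n / sqrt(lambda_n) + h_n^2] must be small against
    [lambda_n^((1 + eps) / 2)]; squaring the bias part gives the [h_n^4]. The variance is controlled
    on average over [k < n] and not for each [k]: the steps before the random index admit only a
    crude bound, and averaging makes their finite total contribution negligible. *)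

Section change_of_variables.
Context {R : realType}.
Local Open Scope ereal_scope.

(** The substitution [y = x - b u], which turns a kernel centred at [x] into [K u]. The reflection
    is built in, so no symmetry of [K] is ever required. *)
Definition refl_scale (a c : R) (t : measurableTypeR R) : measurableTypeR R :=
    (a - c * t)%R.

Lemma measurable_refl_scale a c : measurable_fun setT (refl_scale a c).
Proof. by apply: measurable_funB => //; exact: mulrl_measurable. Qed.

Lemma lebesgue_measure_refl_scale (a c : R) (A : set (measurableTypeR R)) :
  (0 < c)%R -> measurable A ->
  lebesgue_measure A = c%:E * pushforward lebesgue_measure (refl_scale a c) A.
Proof.
move=> c0 mA.
pose k : {nonneg R} := NngNum (ltW c0).
have mf := @measurable_refl_scale a c.
(* [pushforward] is canonically a measure only through a measurability proof,
   which unification cannot guess. *)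
pose pm := measure_function_pushforward__canonical__measure_function_Measure
    (@lebesgue_measure R) mf.
pose m := mscale k pm.
rewrite (lebesgue_measure_unique (mu := m))//= => {mA A} _ [[l r]] _ <-.
rewrite /m /mscale/= /pushforward.
(* The map reverses orientation, so left-open intervals pull back to right-open ones; only their
   length matters. *)
have -> : refl_scale a c @^-1` [set` `]l, r]] = [set` `[(a - r) / c, (a - l) / c[]%R.
  apply/seteqP; split => t /=; rewrite !in_itv/= /refl_scale ler_pdivrMr//
      ltr_pdivlMr// mulrC => /andP[H1 H2]; apply/andP; split; lra.
rewrite !lebesgue_measure_itv/= !lte_fin ltr_pM2r ?invr_gt0// ltrD2l ltrN2.
case: ifPn => lr; last by rewrite mule0.
rewrite -!EFinB -EFinM; congr EFin; field; exact: lt0r_neq0.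
Qed.

Lemma ge0_integral_refl_scale (a c : R) (F : measurableTypeR R -> \bar R) :
  (0 < c)%R -> measurable_fun setT F -> (forall x, 0 <= F x) ->
  \int[lebesgue_measure]_t F t = c%:E * \int[lebesgue_measure]_t F (a - c * t)%R.
Proof.
move=> c0 mF F0.
pose k : {nonneg R} := NngNum (ltW c0).
have mf := @measurable_refl_scale a c.
pose pm := measure_function_pushforward__canonical__measure_function_Measure
    (@lebesgue_measure R) mf.
pose m := mscale k pm.
rewrite (@eq_measure_integral _ _ _ setT m) => [|A mA _];
    last exact: lebesgue_measure_refl_scale.
by rewrite ge0_integral_mscale// ge0_integral_pushforward.
Qed.

Lemma ge0_integral_rV_S n (F : 'rV[R]_n.+1 -> \bar R) :
  measurable_fun setT F -> (forall x, 0 <= F x) ->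
  \int[lebesgue_rV n.+1]_x F x =
  \int[lebesgue_measure]_t \int[lebesgue_rV n]_v F (rV_cons (t, v)).
Proof.
move=> mF F0 /=.
rewrite ge0_integral_pushforward//; last exact: measurable_rV_cons.
rewrite preimage_setT fubini_tonelli1//.
  exact: measurableT_comp (@measurable_rV_cons _ _).
by move=> x; exact: F0.
Qed.

Lemma refl_scale_coord n (a v : 'rV[R]_n) (c : R) i :
  ((a - c *: v) ord0 i = a ord0 i - c * v ord0 i)%R.
Proof. by rewrite !mxE. Qed.

Lemma measurable_rV_refl_scale n (a : 'rV[R]_n) (c : R) :
  measurable_fun setT (fun v : 'rV[R]_n => a - c *: v)%R.
Proof.
apply: measurable_fun_rV => i; under eq_fun do rewrite !mxE.
apply: measurable_funB => //.
apply: measurableT_comp; [exact: mulrl_measurable|exact: measurable_coord].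
Qed.

(** By induction on the dimension: Tonelli splits off the first coordinate, whose substitution
    contributes one factor [c], and the induction hypothesis handles the others with the tail of [a]
    as centre. *)
Lemma ge0_integral_rV_refl_scale n (a : 'rV[R]_n) (c : R) (F : 'rV[R]_n -> \bar R) :
  (0 < c)%R -> measurable_fun setT F -> (forall x, 0 <= F x) ->
  \int[lebesgue_rV n]_x F x = (c ^+ n)%:E * \int[lebesgue_rV n]_x F (a - c *: x)%R.
Proof.
move=> c0; elim: n a F => [|n IH] a F mF F0.
  rewrite expr0 mul1e; apply: eq_integral => x _; congr F; apply/rowP; by case.
have mFs t : measurable_fun setT (fun v => F (rV_cons (t, v))).
  apply: measurableT_comp => //; apply: measurableT_comp => //.
  exact: measurable_rV_cons.
rewrite !ge0_integral_rV_S//; last first.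
  apply: measurableT_comp => //; exact: measurable_rV_refl_scale.
rewrite (ge0_integral_refl_scale (a ord0 ord0) c0); last 2 first.
- apply: (measurable_fun_fubini_tonelli_F (F \o @rV_cons R n)).
    apply: measurableT_comp => //; exact: measurable_rV_cons.
  by move=> x; exact: F0.
- by move=> x; exact: integral_ge0.
pose a' : 'rV[R]_n := (\row_j a ord0 (lift ord0 j))%R.
have E t : \int[lebesgue_rV n]_v F (rV_cons ((a ord0 ord0 - c * t)%R,
    v)) = (c ^+ n)%:E * \int[lebesgue_rV n]_v F (a - c *: rV_cons (t, v))%R.
  rewrite (IH a')//; congr (_ * _); apply: eq_integral => v _; congr F.
  apply/rowP => i; rewrite refl_scale_coord !rV_consE.
  by case: unliftP => [j ->|->]//=; rewrite !mxE.
under eq_integral do rewrite E.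
rewrite ge0_integralZl//; last 3 first.
- apply: (measurable_fun_fubini_tonelli_F (fun x => F (a - c *: rV_cons x)%R)).
    apply: measurableT_comp => //.
    exact: (measurableT_comp (measurable_rV_refl_scale a c) (@measurable_rV_cons R n)).
  by move=> x; exact: F0.
- by move=> x _; exact: integral_ge0.
- by rewrite lee_fin exprn_ge0// ltW.
by rewrite muleA -EFinM exprS.
Qed.
End change_of_variables.

(** * Conditioning on the history *)

Section density_integral.
Local Open Scope ereal_scope.
Context d (T : measurableType d) (R : realType).
Variables (mu nu : {measure set T -> \bar R}) (g : T -> R).
Hypotheses (mg : measurable_fun setT g) (g0 : forall x, (0 <= g x)%R).
Hypothesis nuE : forall A, measurable A -> nu A = \int[mu]_(x in A) (g x)%:E.

Import HBNNSimple.

Let nnsfun_density (h : {nnsfun T >-> R}) :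
  \int[nu]_x (h x)%:E = \int[mu]_x ((h x)%:E * (g x)%:E).
Proof.
have mind r : measurable_fun setT (fun x => (r * \1_(h @^-1` [set r]) x)%:E).
  by apply/measurable_EFinP/measurable_funM.
transitivity (\int[nu]_x
   (\sum_(y \in range h) (y * \1_(h @^-1` [set y]) x)%:E)).
  by apply: eq_integral => t tE; rewrite /= fimfunE -fsumEFin.
rewrite ge0_integral_fsum//; last by move=> m y Ey; exact: nnfun_muleindic_ge0.
transitivity (\int[mu]_x (\sum_(y \in range h)
    (y * \1_(h @^-1` [set y]) x)%:E * (g x)%:E)); last first.
  apply: eq_integral => x xE.
  rewrite -ge0_mule_fsuml => [|y]; last exact: nnfun_muleindic_ge0.
  by rewrite fsumEFin // -(fimfunE _ x).
rewrite ge0_integral_fsum//; last 2 first.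
  - by move=> y; apply: emeasurable_funM => //; exact/measurable_EFinP.
  - by move=> m y Ey; rewrite mule_ge0 ?lee_fin// -lee_fin nnfun_muleindic_ge0.
apply: eq_fsbigr => r rhn.
under [LHS]eq_integral do rewrite EFinM.
rewrite integralZl_indic_nnsfun => //.
under [RHS]eq_integral do rewrite EFinM -muleA.
rewrite ge0_integralZl//.
- under [in RHS]eq_integral do rewrite muleC.
  rewrite [in RHS](eq_integral ((EFin \o g) \_ (h @^-1` [set r]))); last first.
    by move=> x xE; rewrite epatch_indic.
  by rewrite -integral_mkcond -nuE// integral_indic// setIT.
- by apply: emeasurable_funM; exact/measurable_EFinP.
- by move=> t Et; rewrite mule_ge0 ?lee_fin.
- by move: rhn; rewrite inE => -[t _ <-]; rewrite lee_fin.
Qed.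

(** The usual passage from sets to simple functions to monotone limits. It is needed because the law
    predicted by the policy is known through its values on sets. *)
Lemma ge0_integral_density (f : T -> \bar R) :
  measurable_fun setT f -> (forall x, 0 <= f x) ->
  \int[nu]_x f x = \int[mu]_x (f x * (g x)%:E).
Proof.
move=> mf f0; pose h := nnsfun_approx measurableT mf.
have -> : \int[nu]_x f x = lim (\int[nu]_x (EFin \o h n) x @[n --> \oo]).
  have fE x : f x = lim ((EFin \o h n) x @[n --> \oo]).
    by apply/esym/cvg_lim => //; exact: cvg_nnsfun_approx.
  under eq_integral do rewrite fE.
  apply: monotone_convergence => //.
  - by move=> n; exact/measurable_EFinP.
  - by move=> n x Ex //=; rewrite lee_fin.
  - by move=> x Ex a b ab; rewrite lee_fin; exact/lefP/nd_nnsfun_approx.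
have -> : \int[mu]_x (f x * (g x)%:E) =
    lim (\int[mu]_x ((h n x)%:E * (g x)%:E) @[n --> \oo]).
  have fg x : f x * (g x)%:E = lim ((h n x)%:E * (g x)%:E @[n --> \oo]).
    by apply/esym/cvg_lim => //; apply: cvgeZr => //; exact: cvg_nnsfun_approx.
  under eq_integral do rewrite fg.
  apply: monotone_convergence => //.
  - by move=> n; apply: emeasurable_funM; exact/measurable_EFinP.
  - by move=> n x Ex /=; rewrite mule_ge0 ?lee_fin.
  - by move=> x Ex a b ab/=; rewrite lee_wpmul2r ?lee_fin//; exact/lefP/nd_nnsfun_approx.
by under eq_fun do rewrite nnsfun_density.
Qed.

End density_integral.

Section disintegration.
Context {R : realType} {d : nat} {dO : measure_display}
  {Omega : measurableType dO} {P : probability Omega R}.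
Variable X : nat -> {RV P >-> 'rV[R]_d}.
Local Open Scope ereal_scope.

Lemma history_measurable k A : history X k A -> measurable A.
Proof.
apply: smallest_sub; first exact: sigma_algebra_measurable.
move=> B; rewrite -bigcup_seq/= => -[i _ [C mC <-]].
by apply: measurable_funP.
Qed.

(** The type generates a sigma-algebra from [history X k], which is already one, and generation is
    idempotent. *)
Lemma measurable_historyE k (A : set (g_sigma_algebraType (history X k))) :
  measurable A = history X k A.
Proof.
rewrite /measurable/= sigma_algebra_id//.

exact: smallest_sigma_algebra.
Qed.

Lemma history_leq k n : (k <= n)%N -> history X k `<=` history X n.
Proof.
move=> kn; apply: sub_sigma_algebra2.
move=> B; rewrite -!bigcup_seq/= => -[i _ [C mC <-]].
exists (widen_ord kn i) => /=; first by rewrite mem_index_enum.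
by exists C.
Qed.

Lemma measurable_history_leq d' (T : measurableType d') k n (f : Omega -> T) : (k <= n)%N ->
  measurable_fun [set: g_sigma_algebraType (history X k)] f ->
  measurable_fun [set: g_sigma_algebraType (history X n)] f.
Proof.
move=> kn mf _ B mB.
by have := mf measurableT _ mB; rewrite !measurable_historyE; exact: history_leq.
Qed.

Lemma measurable_history d' (T : measurableType d') k (f : Omega -> T) :
  measurable_fun [set: g_sigma_algebraType (history X k)] f -> measurable_fun setT f.
Proof.
move=> mf _ B mB.
by have := mf measurableT _ mB; rewrite measurable_historyE; exact: history_measurable.
Qed.

Lemma measurable_history_X k n : (0 < k <= n)%N ->
  measurable_fun [set: g_sigma_algebraType (history X n)] (X k).
Proof.
case: k => // k /= kn _ B mB; rewrite measurable_historyE.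
apply: sub_sigma_algebra; rewrite -bigcup_seq/=.
exists (Ordinal kn) => /=; first by rewrite mem_index_enum.
by exists B.
Qed.

Variable q : nat -> Omega -> 'rV[R]_d -> R.
Hypothesis polq : is_policy X q.

Let H k := g_sigma_algebraType (history X k).
Let mid k : measurable_fun [set: Omega] (id : Omega -> H k).
Proof. by move=> _ B; rewrite measurable_historyE setTI => /history_measurable. Qed.

(** [P] restricted to the history: the identity defining a policy holds only for events [A] of the
    history, so the two joint laws can be compared only on the product of that sigma-algebra with
    the Borel sets. *)
Let PH k : {measure set (H k) -> \bar R} :=
  measure_function_pushforward__canonical__measure_function_Measure P (@mid k).

Let PHE k (F : H k -> \bar R) : measurable_fun setT F -> (forall w, 0 <= F w) ->
  \int[PH k]_w F w = \int[P]_w F w.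
Proof. by move=> mF F0; rewrite ge0_integral_pushforward. Qed.

Let PH_sigma_finite k : sigma_finite setT (PH k).
Proof.
exists (fun=> setT); first by rewrite bigcup_const.
by move=> i; split => //; rewrite /PH/= /pushforward preimage_setT probability_setT ltry.
Qed.

Let PHs k : {sigma_finite_measure set (H k) -> \bar R} :=
  HB.pack (PH k : set (H k) -> \bar R) (Measure.on (PH k)) (Measure_isSigmaFinite.Build
      _ _ _ (PH k) (@PH_sigma_finite k)).

Let joint k (w : Omega) : H k * 'rV[R]_d := (w, X k.+1 w).

Let mjoint k : measurable_fun setT (@joint k).
Proof.
by apply: measurable_fun_pair; [exact: mid|].
Qed.

Let qe k (z : H k * 'rV[R]_d) : \bar R := (q k z.1 z.2)%:E.

Let mqe k : measurable_fun setT (@qe k).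
Proof. by have [_ mq _] := polq; apply/measurable_EFinP; exact: mq. Qed.

Let qe_ge0 k z : 0 <= @qe k z.
Proof. by have [q1 _ _] := polq; rewrite lee_fin; have [] := q1 k z.1. Qed.

Let nu k (C : set (H k * 'rV[R]_d)) := \int[PHs k \x lebesgue_rV d]_(z in C) qe z.

Let nu0 k : @nu k set0 = 0. Proof. exact: integral_set0. Qed.

Let nu_ge0 k C : 0 <= @nu k C. Proof. exact: integral_ge0. Qed.

Let nu_sa k : semi_sigma_additive (@nu k).
Proof. exact: semi_sigma_additive_nng_induced. Qed.

Let num k : {measure set (H k * 'rV[R]_d) -> \bar R} :=
  HB.pack (@nu k) (isMeasure.Build _ _ _ (@nu k) (@nu0 k) (@nu_ge0 k) (@nu_sa k)).

Let nu_rect k (A : set (H k)) B : measurable A -> measurable B ->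
  @nu k (A `*` B) = P (A `&` X k.+1 @^-1` B).
Proof.
move=> mA mB; have [_ _ qX] := polq.
have mA' : measurable (A : set Omega).
  by move: mA; rewrite measurable_historyE; exact: history_measurable.
rewrite qX//; last by rewrite -measurable_historyE.
have mAB : measurable (A `*` B) by exact: measurableX.
rewrite /nu integral_mkcond fubini_tonelli1; last 2 first.
- by apply/(measurable_restrictT _ _).1 => //; exact: measurable_funTS.
- by apply: erestrict_ge0 => z _; exact: qe_ge0.
have mq2 : measurable_fun setT (fun z : H k * 'rV[R]_d => ((qe (k:=k)) \_ (A `*` B)) z).
  by apply/(measurable_restrictT _ _).1 => //; exact: measurable_funTS.
have q2 z : 0 <= ((qe (k:=k)) \_ (A `*` B)) z.
  by apply: erestrict_ge0 => {}z _; exact: qe_ge0.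
rewrite PHE; last 2 first.
- by apply: (measurable_fun_fubini_tonelli_F ((qe (k:=k)) \_ (A `*` B))).
- by move=> w; exact: integral_ge0.
rewrite [RHS]integral_mkcond; apply: eq_integral => w _.
rewrite /fubini_F patchE; case: ifPn => [/set_mem Aw|/negP Aw].
  rewrite [RHS]integral_mkcond; apply: eq_integral => x _.
  rewrite !patchE; congr (if _ then _ else _).
  by apply/idP/idP => /set_mem; [move=> []|move=> Bx]; rewrite inE.
apply: integral0_eq => x _; rewrite patchE ifN//.
by apply/negP => /set_mem[] /mem_set.
Qed.

(** The law of the pair (history, next sample) and the measure with density [q k] agree on
    rectangles by definition of a policy; rectangles form a generating pi-system, so the measures
    coincide. This replaces conditional expectations: the next sample is integrated out against
    [q k], with the past kept as a parameter. *)
Lemma integral_next k (G : g_sigma_algebraType (history X k) * 'rV[R]_d -> \bar R) :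
  measurable_fun setT G -> (forall z, 0 <= G z) ->
  \int[P]_w G (w, X k.+1 w) =
  \int[P]_w \int[lebesgue_rV d]_x (G (w, x) * (q k w x)%:E).
Proof.
move=> mG G0.
pose nu1 := measure_function_pushforward__canonical__measure_function_Measure P (@mjoint k).
have nuE C : measurable C -> nu1 C = num k C.
  apply: (measure_unique [set A `*` B | A in measurable & B in measurable] (fun=>
      setT)) => //.
  - by rewrite measurable_prod_measurableType.
  - move=> _ _ [A1 mA1 [A2 mA2 <-]] [B1 mB1 [B2 mB2 <-]].
    exists (A1 `&` B1); first exact: measurableI.
    exists (A2 `&` B2); first exact: measurableI.
    by rewrite setXI.
  - by move=> _; exists setT => //; exists setT => //; rewrite setXTT.
  - by rewrite bigcup_const.
  - by move=> _ [A mA [B mB <-]]; rewrite [RHS]nu_rect.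
  - by move=> _; rewrite /nu1/= /pushforward preimage_setT probability_setT ltry.
transitivity (\int[nu1]_z G z); first by rewrite ge0_integral_pushforward.
rewrite (eq_measure_integral (num k)); last by move=> C mC _; exact: nuE.
have mGq : measurable_fun setT (fun z : H k * 'rV[R]_d => G z * (q k z.1 z.2)%:E).
  by apply: emeasurable_funM => //; exact: mqe.
have Gq0 z : 0 <= G z * (q k z.1 z.2)%:E by apply: mule_ge0 => //; exact: qe_ge0.
rewrite (@ge0_integral_density _ _ _ (PHs k \x lebesgue_rV d)%E (num k) (fun z =>
    q k z.1 z.2))//.
- rewrite fubini_tonelli1// PHE//.
    exact: (measurable_fun_fubini_tonelli_F (fun z => G z * (q k z.1 z.2)%:E)).
  by move=> w; exact: integral_ge0.
- by have [_ mq _] := polq; exact: mq.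
- by move=> x; rewrite -lee_fin; exact: (@qe_ge0 k).
Qed.

End disintegration.

(** * Exponential supermartingale and tail bound *)

(** Since [expR (- u / 2) >= 1 - u / 2], one has [expR u <= (1 - u / 2)^-2]. Moreover
    [(1 + u + u^2) (1 - u / 2)^2] equals [1 + u^2 (1 - 3 u + u^2) / 4], at least 1 when
    [|u| <= 1/4]. All later occurrences of [4^-1] as a bound on [theta g] come from here. *)
Lemma expR_le_quadratic (R : realType) (u : R) :
  `|u| <= 4^-1 -> expR u <= 1 + u + u ^+ 2.
Proof.
rewrite ler_norml => /andP[u1 u2].
have e2 : expR u = expR (u / 2) ^+ 2 by rewrite -expRM_natl mulr_natl -mulr_natr divfK.
have := expR_ge1Dx (- (u / 2)); rewrite expRN -[leRHS]div1r ler_pdivlMr ?expR_gt0// => h.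
have eu := expR_gt0 (u / 2); rewrite e2; move: h eu; set e := expR _ => h eu.
have h1 : ((1 - u / 2) * e) ^+ 2 <= 1 by rewrite expr_le1//; nra.
have h2 : 1 <= (1 + u + u ^+ 2) * (1 - u / 2) ^+ 2.
  rewrite [leRHS](_ : _ = 1 + u ^+ 2 * ((1 - 3 * u + u ^+ 2) / 4)); last by field.
  by rewrite lerDl mulr_ge0 ?sqr_ge0// divr_ge0//; nra.
have h3 : 0 < (1 - u / 2) ^+ 2 by rewrite exprn_gt0//; lra.
rewrite -(ler_pM2l h3) -exprMn; apply: (le_trans h1); rewrite mulrC//.
Qed.

Section mgf.
Local Open Scope ereal_scope.
Context dT (T : measurableType dT) (R : realType) (mu : {measure set T -> \bar R}).
Variables (p g : T -> R) (theta : R).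
Hypotheses (mp : measurable_fun setT p) (p0 : forall x, (0 <= p x)%R)
  (p1 : \int[mu]_x (p x)%:E = 1).
Hypotheses (mg : measurable_fun setT g) (gtheta : forall x, (`|theta * g x| <= 4^-1)%R).
Hypothesis theta0 : (theta != 0)%R.

Let gb x : (`|g x| <= `|theta|^-1)%R.
Proof.
rewrite -div1r ler_pdivlMr ?normr_gt0// -normrM mulrC.
by apply: le_trans (gtheta x) _; rewrite invf_le1// ler1n.
Qed.

Let integrable_p : mu.-integrable setT (EFin \o p).
Proof.
apply/integrableP; split; first exact/measurable_EFinP.
under eq_integral do rewrite /= ger0_norm//.
by rewrite p1 ltry.
Qed.

Let integrable_gp (k : nat) : mu.-integrable setT (fun x => (g x ^+ k * p x)%:E).
Proof.
apply: (@le_integrable _ _ _ mu _ measurableT _ (fun x => ((`|theta|^-1 ^+ k) * p x)%:E)).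
- by apply/measurable_EFinP/measurable_funM => //; exact: measurable_funX.
- move=> x _; rewrite !abse_EFin lee_fin !normrM ler_wpM2r// normrX.
  rewrite [leRHS]ger0_norm ?exprn_ge0 ?invr_ge0//.
  by apply: lerXn2r; rewrite ?nnegrE// ?invr_ge0.
- under eq_fun do rewrite EFinM; exact: integrableZl.
Qed.

Let m := fine (\int[mu]_x (g x * p x)%:E).
Let v := fine (\int[mu]_x (g x ^+ 2 * p x)%:E).

(** Integrating the quadratic bound gives [1 + theta m + theta^2 v], which is at most
    [expR (theta m + theta^2 v)]. Here [v] is the raw second moment, which exceeds the variance but
    has a simple formula for importance weights. As [theta] is nonzero, the bound on [theta g] makes
    [g] bounded and the moments finite. *)
Lemma mgf_bound :
  \int[mu]_x (expR (theta * (g x - m) - theta ^+ 2 * v) * p x)%:E <= 1.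
Proof.
have ig := integrable_gp 1; have ig2 := integrable_gp 2.
have Ep x : (p x)%:E = (g x ^+ 0 * p x)%:E by rewrite expr0 mul1r.
have mE : \int[mu]_x (g x ^+ 1 * p x)%:E = m%:E by rewrite fineK//;
    exact: integrable_fin_num.
have vE : \int[mu]_x (g x ^+ 2 * p x)%:E = v%:E by rewrite fineK//;
    exact: integrable_fin_num.
have quad : \int[mu]_x ((1 + theta * g x + (theta * g x) ^+ 2) * p x)%:E
    = (1 + theta * m + theta ^+ 2 * v)%:E.
  transitivity (\int[mu]_x ((p x)%:E + theta%:E * (g x ^+ 1 * p x)%:E +
      (theta ^+ 2)%:E * (g x ^+ 2 * p x)%:E)).
    by apply: eq_integral => x _; rewrite -!EFinM -!EFinD; congr EFin; ring.
  rewrite integralD//; last 2 first.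
  - by apply: integrableD => //; exact: integrableZl.
  - exact: integrableZl.
  rewrite integralD//; last exact: integrableZl.
  by rewrite !integralZl// mE vE p1 -!EFinM -!EFinD.
have eC : (0 < expR (- (theta * m + theta ^+ 2 * v)))%R by exact: expR_gt0.
apply: (@le_trans _ _ ((expR (- (theta * m + theta ^+ 2 * v)))%:E * (1 + theta * m +
    theta ^+ 2 * v)%:E)).
  rewrite -quad -ge0_integralZl//; last 2 first.
  - apply/measurable_EFinP/measurable_funM => //.
    by apply: measurable_funD; [apply: measurable_funD => //|apply: measurable_funX];
        exact: measurable_funM.
  - move=> x _; rewrite lee_fin mulr_ge0//.
    have := sqr_ge0 (theta * g x + 1)%R; have := sqr_ge0 (theta * g x)%R; nra.
  apply: ge0_le_integral => //.
  - by move=> x _; rewrite lee_fin mulr_ge0// expR_ge0.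
  - apply/measurable_EFinP/measurable_funM => //; apply: measurableT_comp => //.
    by apply: measurable_funB => //; apply: measurable_funM => //; exact: measurable_funB.
  - apply: emeasurable_funM => //; apply/measurable_EFinP/measurable_funM => //.
    by apply: measurable_funD; [apply: measurable_funD => //|apply: measurable_funX];
        exact: measurable_funM.
  - move=> x _; rewrite -EFinM lee_fin mulrA ler_wpM2r//.
    rewrite (_ : _ - _ = - (theta * m + theta ^+ 2 * v) + theta * g x)%R; last by ring.
    by rewrite expRD ler_pM2l// expR_le_quadratic.
rewrite -EFinM lee_fin expRN ler_pdivrMl ?expR_gt0// mulr1.
by rewrite -addrA expR_ge1Dx.
Qed.
End mgf.

Lemma measurable_ge_le d (T : measurableType d) (R : realType) (f g : T -> R) (s v : R) :
  measurable_fun setT f -> measurable_fun setT g ->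
  measurable [set w | s <= f w /\ g w <= v].
Proof.
move=> mf mg; apply: measurableI; rewrite -[X in measurable X]setTI;
  exact: measurable_fun_le.
Qed.

Section concentration.
Local Open Scope ereal_scope.
Context {R : realType} {d : nat} {dO : measure_display}
  {Omega : measurableType dO} {P : probability Omega R}.
Variable X : nat -> {RV P >-> 'rV[R]_d}.
Variable q : nat -> Omega -> 'rV[R]_d -> R.
Hypothesis polq : is_policy X q.
Variable g : nat -> Omega -> 'rV[R]_d -> R.
Let H k := g_sigma_algebraType (history X k).
Hypothesis mg : forall k, measurable_fun [set: H k * 'rV[R]_d] (fun z => g k z.1 z.2).
Hypothesis g0 : forall k w x, (0 <= g k w x)%R.

(** The conditional moment of [g k w (X k.+1 w)] given [history X k], written as an explicit
    function of the path through the density [q k]. *)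
Definition cond_moment (j k : nat) (w : Omega) : R :=
  fine (\int[lebesgue_rV d]_x (g k w x ^+ j * q k w x)%:E).

Definition deviation (n : nat) (w : Omega) : R :=
  (\sum_(k < n) (g k w (X k.+1 w) - cond_moment 1 k w))%R.

Definition quad_var (n : nat) (w : Omega) : R :=
  (\sum_(k < n) cond_moment 2 k w)%R.

Lemma measurable_cond_moment j k : measurable_fun [set: H k] (cond_moment j k).
Proof.
have [q1 mq _] := polq.
apply: measurableT_comp; first exact: fine_measurable.
apply: (@measurable_fun_fubini_tonelli_F _ _ _ _ _ (lebesgue_rV d) (fun z :
    H k * 'rV[R]_d => (g k z.1 z.2 ^+ j * q k z.1 z.2)%:E)).
  apply/measurable_EFinP/measurable_funM; last exact: mq.
  exact: measurable_funX.
by move=> z; rewrite lee_fin mulr_ge0 ?exprn_ge0//; have [] := q1 k z.1.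
Qed.

Lemma measurable_deviation n : measurable_fun [set: H n] (deviation n).
Proof.
apply: measurable_sum => k; apply: measurable_funB; last first.
  by apply: (measurable_history_leq (ltnW (ltn_ord k))); exact: measurable_cond_moment.
have mp : measurable_fun [set: H n] (fun w => (w, X k.+1 w) : H k * 'rV[R]_d).
  apply: measurable_fun_pair; last by apply: measurable_history_X; rewrite ltn0Sn/= ltn_ord.
  by apply: (measurable_history_leq (ltnW (ltn_ord k))); exact: (@measurable_id _ (H k)).
exact: (measurableT_comp (@mg k) mp).
Qed.

Lemma measurable_quad_var n : measurable_fun [set: H n] (quad_var n).
Proof.
apply: measurable_sum => k.
by apply: (measurable_history_leq (ltnW (ltn_ord k))); exact: measurable_cond_moment.
Qed.

Variable theta : R.
Hypothesis theta0 : (theta != 0)%R.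

Let Z n w := expR (theta * deviation n w - theta ^+ 2 * quad_var n w)%R.

Let mZ n : measurable_fun [set: H n] (Z n).
Proof.
apply: measurableT_comp => //.
apply: measurable_funB; apply: measurable_funM => //.
  exact: measurable_deviation.
exact: measurable_quad_var.
Qed.

(** By induction: the factors of the first [n] steps and the last two conditional moments are
    functions of the history, so [integral_next] integrates out the last sample alone, and
    [mgf_bound] bounds its factor by 1 for each [w]. *)
Lemma exp_supermartingale n :
  (forall k w x, (k < n)%N -> `|theta * g k w x| <= 4^-1)%R ->
  \int[P]_w (expR (theta * deviation n w - theta ^+ 2 * quad_var n w))%:E <= 1.
Proof.
have [q1 mq _] := polq.
elim: n => [|n IH] gb.
  under eq_integral do rewrite /deviation /quad_var !big_ord0 !mulr0 subr0 expR0.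
  by rewrite integral_cst// mul1e; exact: probability_le1.
apply: le_trans (IH _); last by move=> k w x kn; apply: gb; exact: ltnW.
pose G (z : H n * 'rV[R]_d) := (Z n z.1 * expR (theta * (g n z.1 z.2 - cond_moment 1 n
    z.1) - theta ^+ 2 * cond_moment 2 n z.1))%:E.
have mfst f : measurable_fun [set: H n] f ->
    measurable_fun [set: H n * 'rV[R]_d] (fun z => f z.1 : R).
  by move=> mf; apply: measurableT_comp.
have mE : measurable_fun [set: H n * 'rV[R]_d] (fun z =>
    expR (theta * (g n z.1 z.2 - cond_moment 1 n z.1) - theta ^+ 2 * cond_moment 2 n
        z.1)%R).
  apply: measurableT_comp => //; apply: measurable_funB; apply: measurable_funM => //.
    by apply: measurable_funB => //; apply: mfst; exact: measurable_cond_moment.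
  by apply: mfst; exact: measurable_cond_moment.
have mG : measurable_fun setT G.
  by apply/measurable_EFinP/measurable_funM => //; exact: mfst.
have G0 z : 0 <= G z by rewrite lee_fin mulr_ge0// expR_ge0.
rewrite [leLHS](_ : _ = \int[P]_w G (w, X n.+1 w)); last first.
  apply: eq_integral => w _; rewrite /G /Z /= -expRD; congr (expR _)%:E.
  by rewrite /deviation /quad_var !big_ord_recr/=; ring.
rewrite (integral_next polq)//.
have mq' : measurable_fun setT (fun z : H n * 'rV[R]_d => (q n z.1 z.2)%:E).
  by apply/measurable_EFinP; exact: mq.
have q0 w x : (0 <= q n w x)%R by have [_ ] := q1 n w.
apply: ge0_le_integral => //.
- by move=> w _; apply: integral_ge0 => x _; apply: mule_ge0 => //; rewrite lee_fin.
- apply: (@measurable_history _ _ _ _ _ X _ _ n).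
  apply: (@measurable_fun_fubini_tonelli_F _ _ _ _ _ (lebesgue_rV d) (fun z =>
      G z * (q n z.1 z.2)%:E)).
    exact: emeasurable_funM.
  by move=> z; apply: mule_ge0 => //; rewrite lee_fin.
- by apply/measurable_EFinP; apply: measurable_history; exact: mZ.
move=> w _.
have [mqw _ qw1] := q1 n w.
have mgw : measurable_fun setT (g n w).
  have mpw : measurable_fun setT (fun x : 'rV[R]_d => (w, x) : H n * 'rV[R]_d).
    by apply: measurable_fun_pair.
  exact: (measurableT_comp (@mg n) mpw).
have mgf : \int[lebesgue_rV d]_x (expR (theta * (g n w x - cond_moment 1 n w)
    - theta ^+ 2 * cond_moment 2 n w) * q n w x)%:E <= 1.
  by apply: mgf_bound => // x; exact: gb.
rewrite -[leRHS]mule1; apply: le_trans; last first.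
  by apply: lee_wpmul2l mgf; rewrite lee_fin expR_ge0.
have mexp c : measurable_fun setT (fun x =>
    (expR (theta * (g n w x - cond_moment 1 n w) - c) * q n w x)%:E).
  apply/measurable_EFinP/measurable_funM => //; apply: measurableT_comp => //.
  by apply: measurable_funB => //; apply: measurable_funM => //; exact: measurable_funB.
rewrite -ge0_integralZl ?lee_fin ?expR_ge0//; last first.
  by move=> x _; rewrite lee_fin mulr_ge0 ?expR_ge0.
rewrite le_eqVlt; apply/orP; left; apply/eqP; apply: eq_integral => x _.
by rewrite /G /Z /cond_moment /= -!EFinM mulrA.
Qed.

(** Markov's inequality: on the event, the exponential is at least [expR (s - theta^2 v)]. Keeping
    [theta] of either sign lets the same lemma give both tails. *)
Lemma one_sided_tail n (s v : R) :
  (forall k w x, (k < n)%N -> `|theta * g k w x| <= 4^-1)%R ->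
  P [set w | (s <= theta * deviation n w) /\ (quad_var n w <= v)]%R
  <= (expR (theta ^+ 2 * v - s))%:E.
Proof.
move=> gb; set E := [set w | _].
have mdev : measurable_fun setT (deviation n) by apply: measurable_history;
    exact: measurable_deviation.
have mqv : measurable_fun setT (quad_var n) by apply: measurable_history;
    exact: measurable_quad_var.
have mE : measurable E.
  by apply: measurable_ge_le => //; exact: measurable_funM.
have mZ' : measurable_fun setT (fun w => (Z n w)%:E).
  by apply/measurable_EFinP; apply: measurable_history; exact: mZ.
have c0 : (0 < expR (theta ^+ 2 * v - s))%R by exact: expR_gt0.
have : (expR (s - theta ^+ 2 * v))%:E * P E <= 1.
  rewrite -integral_cst//.
  apply: le_trans (exp_supermartingale gb).
  apply: (@le_trans _ _ (\int[P]_(w in E) (Z n w)%:E)).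
    apply: ge0_le_integral => //.
    - by move=> w _; rewrite lee_fin expR_ge0.
    - exact: measurable_funTS.
    - move=> w [h1 h2]; rewrite lee_fin ler_expR.
      by apply: lerB => //; rewrite ler_wpM2l ?sqr_ge0.
  by apply: ge0_subset_integral => // w _; rewrite lee_fin expR_ge0.
by rewrite -lee_pdivlMl ?expR_gt0// mule1 -expRN opprB.
Qed.
End concentration.

Section two_sided.
Context {R : realType} {d : nat} {dO : measure_display}
  {Omega : measurableType dO} {P : probability Omega R}.
Variable X : nat -> {RV P >-> 'rV[R]_d}.
Variable q : nat -> Omega -> 'rV[R]_d -> R.
Hypothesis polq : is_policy X q.
Variable g : nat -> Omega -> 'rV[R]_d -> R.
Hypothesis mg : forall k, measurable_fun
  [set: g_sigma_algebraType (history X k) * 'rV[R]_d] (fun z => g k z.1 z.2).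
Hypothesis g0 : forall k w x, 0 <= g k w x.

Lemma measurable_deviation_event n (t v : R) : measurable
  [set w | t <= `|deviation X q g n w| /\ quad_var q g n w <= v].
Proof.
have mdev : measurable_fun setT (deviation X q g n).
  by apply: measurable_history; exact: measurable_deviation.
have mqv : measurable_fun setT (quad_var q g n).
  by apply: measurable_history; apply: (measurable_quad_var polq mg g0).
by apply: measurable_ge_le => //; exact: measurableT_comp.
Qed.

Lemma deviation_tail n (theta t v : R) : 0 < theta ->
  (forall k w x, (k < n)%N -> theta * g k w x <= 4^-1) ->
  (P [set w | t <= `|deviation X q g n w| /\ quad_var q g n w <= v]%R
   <= (2 * expR (theta ^+ 2 * v - theta * t))%:E)%E.
Proof.
move=> th0 gb.
have gb' k w x : (k < n)%N -> `|theta * g k w x| <= 4^-1.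
  by move=> kn; rewrite ger0_norm ?gb// mulr_ge0// ltW.
have gbN k w x : (k < n)%N -> `|(- theta) * g k w x| <= 4^-1.
  by move=> kn; rewrite mulNr normrN gb'.
have thN : - theta != 0 by rewrite oppr_eq0 gt_eqF.
have := one_sided_tail polq mg g0 (lt0r_neq0 th0) (theta * t) v gb'.
have := one_sided_tail polq mg g0 thN (theta * t) v gbN.
rewrite sqrrN; set E1 := (X in (P X <= _)%E) => P1; set E2 := (X in (P X <= _)%E) => P2.
have mE1 : measurable E1.
  have mdev : measurable_fun setT (deviation X q g n).
    by apply: measurable_history; exact: measurable_deviation.
  have mqv : measurable_fun setT (quad_var q g n).
    by apply: measurable_history; apply: (measurable_quad_var polq mg g0).
  by apply: measurable_ge_le => //; exact: measurable_funM.
have mE2 : measurable E2.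
  have mdev : measurable_fun setT (deviation X q g n).
    by apply: measurable_history; exact: measurable_deviation.
  have mqv : measurable_fun setT (quad_var q g n).
    by apply: measurable_history; apply: (measurable_quad_var polq mg g0).
  by apply: measurable_ge_le => //; exact: measurable_funM.
apply: (@le_trans _ _ (P (E1 `|` E2))).
  apply: le_measure; rewrite ?inE//; first exact: measurable_deviation_event.
    exact: measurableU.
  move=> w [h1 h2]; move: h1; rewrite ler_normr => /orP[h1|h1].
    by right; split => //; rewrite ler_pM2l.
  by left; split => //; rewrite mulNr -mulrN ler_pM2l.
apply: (le_trans (measureU2 _ mE1 mE2)).
rewrite mulrDl mul1r EFinD; exact: leeD.
Qed.
End two_sided.

(** * Uniform concentration over growing finite families *)

Section borel_cantelli.
Context d (T : measurableType d) (R : realType) (P : probability T R).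

Lemma sum_inv_consecutive n :
  \sum_(0 <= i < n) (i.+1%:R * i.+2%:R)^-1 <= 1 :> R.
Proof.
have -> : \sum_(0 <= i < n) (i.+1%:R * i.+2%:R)^-1 = - (n.+1%:R^-1) - - (1%:R^-1) :> R.
  apply: (telescope_sumr_eq (fun i => - (i.+1%:R^-1 : R))) => // i _.
  have h1 : i.+1%:R != 0 :> R by rewrite pnatr_eq0.
  have h2 : i.+1%:R + 1 != 0 :> R by rewrite natr1 pnatr_eq0.
  by rewrite -[i.+2%:R]natr1; field; apply/andP.
by rewrite invr1 opprK addrC gerBl invr_ge0.
Qed.

Lemma ae_eventually_not (E : nat -> set T) (N : nat) :
  (forall n, measurable (E n)) ->
  (forall n, (N <= n)%N -> (P (E n) <= ((n.+1%:R * n.+2%:R)^-1)%:E)%E) ->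
  \forall w \ae P, \forall n \near \oo, ~ E n w.
Proof.
move=> mE PE.
(* Discarding the events below [N] does not affect what happens eventually, and it puts every term
   of the series under the telescoping majorant. *)
pose E' n := if (N <= n)%N then E n else set0.
have mE' n : measurable (E' n) by rewrite /E'; case: ifP.
have PE' n : (P (E' n) <= ((n.+1%:R * n.+2%:R)^-1)%:E)%E.
  rewrite /E'; case: ifP => [/PE//|_].
  by rewrite measure0 lee_fin invr_ge0 mulr_ge0.
exists (lim_sup_set E'); split.
- apply: bigcap_measurable => // k _; apply: bigcup_measurable => //.
- apply: lim_sup_set_cvg0 => //.
  apply: (@le_lt_trans _ _ 1%E); last exact: ltry.
  apply: lime_le; first by apply: is_cvg_nneseries => n _ _; exact: measure_ge0.
  apply: nearW => n.
  apply: (@le_trans _ _ (\sum_(0 <= i < n) ((i.+1%:R * i.+2%:R)^-1)%:E)%E).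
    by apply: lee_sum => i _; exact: PE'.
  by rewrite sumEFin lee_fin sum_inv_consecutive.
- move=> w /= Hw n _ /=; apply: contrapT => H; apply: Hw.
  exists (maxn n N) => // m /= nm Em; apply: H.
  exists m => /=; first exact: leq_trans (leq_maxl _ _) nm.
  by rewrite /E' (leq_trans (leq_maxr _ _) nm).
Qed.

Lemma measure_bigsetU_le (I : Type) (s : seq I) (E : I -> set T) (e : \bar R) :
  (forall i, measurable (E i)) -> (forall i, (P (E i) <= e)%E) ->
  (P (\big[setU/set0]_(i <- s) E i) <= (size s)%:R%:E * e)%E.
Proof.
move=> mE PE; elim: s => [|i s IH].
  by rewrite big_nil measure0 mul0e.
rewrite big_cons; apply: le_trans (measureU2 _ (mE i) _) _.
  exact: bigsetU_measurable.
rewrite /= -natr1 addrC EFinD ge0_muleDl// ?mul1e ?lee_fin//.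
exact: leeD.
Qed.

Lemma exists_bigsetU (I : finType) (E : I -> set T) :
  [set w | exists i, E i w] = \big[setU/set0]_(i <- enum I) E i.
Proof.
rewrite -bigcup_seq; apply/seteqP; split => w /=.
  by move=> [i Ei]; exists i => //=; rewrite mem_enum.
by move=> [i _ Ei]; exists i.
Qed.

End borel_cantelli.

Section family_concentration.
Context {R : realType} {d : nat} {dO : measure_display}
  {Omega : measurableType dO} {P : probability Omega R}.
Variable X : nat -> {RV P >-> 'rV[R]_d}.
Variable q : nat -> Omega -> 'rV[R]_d -> R.
Hypothesis polq : is_policy X q.

Let adapted_ge0 (g : nat -> Omega -> 'rV[R]_d -> R) :=
  (forall k, measurable_fun [set: g_sigma_algebraType (history X k) * 'rV[R]_d]
     (fun z => g k z.1 z.2)) /\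
  (forall k w x, 0 <= g k w x).

(** A union bound with [theta = sqrt (L / v)]: then [theta^2 v = L], and [theta] times the threshold
    is [(1 + kappa) L], which leaves the exponent [- kappa L]. *)
Lemma family_tail n (I : finType) (g : I -> nat -> Omega -> 'rV[R]_d -> R)
    (L v kappa b : R) :
  (forall i, adapted_ge0 (g i)) ->
  (forall i k w x, (k < n)%N -> g i k w x <= b) ->
  0 < L -> 0 < v -> Num.sqrt (L / v) * b <= 4^-1 ->
  (P [set w | exists i, (1 + kappa) * Num.sqrt (v * L) <= `|deviation X q (g i) n w| /\
      quad_var q (g i) n w <= v]%R
   <= (#|I|%:R * (2 * expR (- kappa * L)))%:E)%E.
Proof.
move=> ag gb L0 v0 thb.
set E := fun i => [set w | (1 + kappa) * Num.sqrt (v * L) <= `|deviation X q (g i) n w| /\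
      quad_var q (g i) n w <= v]%R.
rewrite (exists_bigsetU E) cardE EFinM.
apply: measure_bigsetU_le => i; have [mg g0] := ag i.
  exact: (measurable_deviation_event polq mg g0).
have th0 : 0 < Num.sqrt (L / v) by rewrite sqrtr_gt0 divr_gt0.
apply: le_trans (deviation_tail polq mg g0 _ _ th0 _) _.
  move=> k w x kn; apply: le_trans thb; rewrite ler_pM2l//; exact: gb.
rewrite lee_fin ler_pM2l// ler_expR.
have Lv0 : 0 <= L / v by rewrite divr_ge0// ltW.
rewrite sqr_sqrtr// divfK ?gt_eqF//.
rewrite [X in _ - X](_ : _ = (1 + kappa) * L).
  by rewrite mulrDl mul1r opprD addrA subrr add0r mulNr.
rewrite mulrCA -sqrtrM//.
rewrite (_ : L / v * (v * L) = L ^+ 2); last by rewrite mulrA divfK ?gt_eqF.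
by rewrite sqrtr_sqr ger0_norm// ltW.
Qed.

(** With [L = ln n], each member fails with probability at most [2 n^(- kappa)], which must beat a
    family of size [n^a] and still be summable. The condition on [quad_var] stays in the conclusion,
    so it may be verified on each path separately. *)
Lemma ae_family_concentration (I : nat -> finType)
    (g : forall n, I n -> nat -> Omega -> 'rV[R]_d -> R)
    (C : R) (a : nat) (v b : nat -> R) :
  (forall n i, adapted_ge0 (@g n i)) ->
  (\forall n \near \oo, (#|I n|%:R <= C * n%:R ^+ a)) ->
  (\forall n \near \oo, forall i k w x, (k < n)%N -> @g n i k w x <= b n) ->
  (\forall n \near \oo, 0 < v n) ->
  (\forall n \near \oo, Num.sqrt (ln n%:R / v n) * b n <= 4^-1) ->
  \forall w \ae P, \forall n \near \oo, forall i, quad_var q (@g n i) n w <= v n ->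
    `|deviation X q (@g n i) n w| <= (1 + (a + 3)%:R) * Num.sqrt (v n * ln n%:R).
Proof.
move=> ag [N0 _ Icard] [N1 _ gb] [N2 _ v0] [N3 _ thb].
(* After the union bound [2 C / n^3] remains: two powers for summability, one to absorb
   constants. *)
pose kappa : R := (a + 3)%:R.
pose E n := [set w | exists i, (1 + kappa) * Num.sqrt (v n * ln n%:R) <=
    `|deviation X q (@g n i) n w| /\
      quad_var q (@g n i) n w <= v n]%R.
have mE n : measurable (E n).
  set F := fun i => [set w | (1 + kappa) * Num.sqrt (v n * ln n%:R) <=
      `|deviation X q (@g n i) n w| /\
      quad_var q (@g n i) n w <= v n]%R.
  rewrite /E (exists_bigsetU F); apply: bigsetU_measurable => i _.
  have [mg g0] := ag n i.
  exact: (measurable_deviation_event polq mg g0).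
(* The 12 is the 2 of the two tails times the 6 of [(n + 1) (n + 2) <= 6 n^2]. *)
pose N4 := (Num.truncn (12 * `|C|)).+1.
have PE n : (N0 + N1 + N2 + N3 + N4 + 2 <= n)%N ->
    (P (E n) <= ((n.+1%:R * n.+2%:R)^-1)%:E)%E.
  move=> nN.
  have [n0' n1 n2 n3 [n4 n5]] : [/\ (N0 <= n)%N, (N1 <= n)%N, (N2 <= n)%N, (N3 <=
      n)%N & (N4 <= n)%N /\ (2 <= n)%N] by split; lia.
  have n0 : 0 < n%:R :> R by rewrite ltr0n; lia.
  have Ln : 0 < ln n%:R :> R by rewrite ln_gt0// ltr1n.
  have := family_tail kappa (ag n) (gb n n1) Ln (v0 n n2) (thb n n3).
  move=> /le_trans; apply.
  rewrite lee_fin.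
  rewrite mulNr expRN /kappa expRM_natl lnK ?posrE//.
  have p0 : 0 < (n.+1%:R * n.+2%:R) :> R by rewrite mulr_gt0.
  rewrite -[leRHS]div1r ler_pdivlMr// mulrA -mulrAC ler_pdivrMr ?exprn_gt0// mul1r.
  have h1 : n.+1%:R * n.+2%:R <= 6 * n%:R ^+ 2 :> R.
    by rewrite -natrX -!natrM ler_nat; nia.
  have h2 : 12 * `|C| <= n%:R.
    by apply: ltW; apply: lt_le_trans (truncnS_gt _) _; rewrite ler_nat.
  have h3 : #|I n|%:R <= `|C| * n%:R ^+ a.
    by apply: le_trans (Icard n n0') _; rewrite ler_wpM2r ?exprn_ge0// ler_norm.
  apply: (@le_trans _ _ (`|C| * n%:R ^+ a * 2 * (6 * n%:R ^+ 2))).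
    by apply: ler_pM => //; rewrite ?mulr_ge0// ler_wpM2r.
  rewrite (_ : _ * _ * _ * _ = (12 * `|C|) * (n%:R ^+ a * n%:R ^+ 2)); last by ring.
  rewrite (_ : n%:R ^+ (a + 3) = n%:R * (n%:R ^+ a * n%:R ^+ 2)); last first.
    by rewrite -exprD -exprS; congr (_ ^+ _); lia.
  by rewrite ler_wpM2r// mulr_ge0// exprn_ge0.
apply: filterS (ae_eventually_not mE PE) => w [N _ HN].
exists N => // n Nn i qv; rewrite leNgt; apply/negP => lt.
by apply: (HN n Nn); exists i; split => //; exact: ltW.
Qed.

End family_concentration.

(** * Euclidean norm and Taylor bound *)

Section enorm_theory.
Context {R : realType} {d : nat}.
Implicit Types x y : 'rV[R]_d.

Lemma enorm_ge0 x : 0 <= enorm x.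
Proof. exact: sqrtr_ge0. Qed.

Lemma enorm_sqr x : enorm x ^+ 2 = \sum_(i < d) x ord0 i ^+ 2.
Proof. by rewrite /enorm sqr_sqrtr// sumr_ge0// => i _; rewrite sqr_ge0. Qed.

Lemma coord_le_enorm x i : `|x ord0 i| <= enorm x.
Proof.
rewrite -(@ler_pXn2r _ 2)// ?nnegrE ?enorm_ge0// enorm_sqr real_normK ?num_real//.
by rewrite (bigD1 i)//= lerDl sumr_ge0// => j _; rewrite sqr_ge0.
Qed.

Lemma enormZ (c : R) x : enorm (c *: x) = `|c| * enorm x.
Proof.
apply/eqP; rewrite -(@eqrXn2 _ 2)// ?mulr_ge0 ?enorm_ge0//.
rewrite exprMn !enorm_sqr real_normK ?num_real// mulr_sumr; apply/eqP.
by apply: eq_bigr => i _; rewrite mxE exprMn.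
Qed.

Lemma enorm_le_coord x (r : R) : 0 <= r ->
  (forall i, `|x ord0 i| <= r) -> enorm x <= d%:R * r.
Proof.
move=> r0 xr.
rewrite -(@ler_pXn2r _ 2)// ?nnegrE ?enorm_ge0 ?mulr_ge0// enorm_sqr.
apply: (@le_trans _ _ (\sum_(i < d) r ^+ 2)).
  by apply: ler_sum => i _; rewrite -[leLHS]real_normK ?num_real// ler_pXn2r ?nnegrE.
rewrite sumr_const card_ord -[leLHS]mulr_natl exprMn ler_wpM2r ?sqr_ge0//.
by rewrite -natrX ler_nat; case: (d) => // n; rewrite expnS expn1 leq_pmulr.
Qed.

Lemma measurable_enorm : measurable_fun setT (enorm : 'rV[R]_d -> R).
Proof.
apply: measurableT_comp.
  by apply: continuous_measurable_fun => r; exact: sqrt_continuous.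
apply: measurable_sum => i; apply: measurable_funX; exact: measurable_coord.
Qed.

End enorm_theory.

Section taylor.
Context {R : realType} {d : nat}.
Implicit Types (f : 'rV[R]_d -> R) (x v : 'rV[R]_d).

Lemma is_derive_line (V : normedModType R) (f : 'rV[R]_d -> V) x v (t : R) :
  differentiable f (x + t *: v) ->
  is_derive t 1 (fun s : R => f (x + s *: v)) ('d f (x + t *: v) v).
Proof.
move=> df.
have E : (fun h : R => h^-1 *: (((fun s :
    R => f (x + s *: v)) \o shift t) (h *: 1) - f (x + t *: v)))
  = (fun h => h^-1 *: ((f \o shift (x + t *: v)) (h *: v) - f (x + t *: v))).
  apply/funext => h; congr (_ *: (f _ - _)).
  by rewrite /= /shift scalerDl -[h *: 1 : R]/(h * 1) mulr1 addrCA.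
have Dv : derivable f (x + t *: v) v by exact: diff_derivable.
have DE : 'D_v f (x + t *: v) = 'd f (x + t *: v) v by exact: deriveE.
constructor; first by rewrite /derivable E; exact: Dv.
by rewrite /derive E; exact: DE.
Qed.

(** The mean value theorem along the segment from [x] to [x + v], applied to [f] and then to its
    derivative. The factor 1/2 of the Taylor formula is lost, which only affects the constant. *)
Lemma taylor2 f : C2 f ->
  (exists M : R, forall x i j, `|hessian f x i j| <= M) ->
  exists2 C : R, 0 <= C & forall x v,
    `|f (x + v) - f x - \sum_i v ord0 i * gradient f x ord0 i| <= C * enorm v ^+ 2.
Proof.
move=> [df dg _] [M HM].
exists (d%:R * (d%:R * `|M|)); first by rewrite !mulr_ge0.
move=> x v.
pose psi (t : R) := \sum_i v ord0 i * gradient f (x + t *: v) ord0 i.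
have dphi (t : R) : is_derive t 1 (fun s : R => f (x + s *: v)) (psi t).
  apply: is_derive_eq; first exact: is_derive_line.
  have dfy := df (x + t *: v).
  rewrite /psi; move: (x + t *: v) dfy => y dfy.
  rewrite {1}(row_sum_delta v) linear_sum; apply: eq_bigr => i _.
  by rewrite linearZ/= mxE deriveE.
pose J (t : R) := \sum_i v ord0 i * (\sum_j v ord0 j * hessian f (x + t *: v) j i).
have dpsi (t : R) : is_derive t 1 psi (J t).
  have -> : psi = \sum_i (fun t : R => v ord0 i * gradient f (x + t *: v) ord0 i).
    by apply/funext => s; rewrite fct_sumE.
  apply: is_derive_sum => i.
  apply: is_deriveZ.
  have Dg := is_derive_line (dg (x + t *: v)).
  have [der Dval] := Dg.
  have gc : derivable (fun s : R =>
      gradient f (x + s *: v) ord0 i) t 1 by move/derivable_mxP : der; exact.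
  apply: DeriveDef => //.
  have := derive_mx der; rewrite Dval => /matrixP /(_ ord0 i); rewrite mxE => <-.
  rewrite -deriveE// deriveEjacobian// mxE; exact: eq_bigr.
have cphi (a b : R) g (dg' : R -> R) : (forall t : R, is_derive t 1 g (dg' t)) ->
    {within `[a, b], continuous g}.
  move=> dd; apply: derivable_within_continuous => t _.
  by have [] := dd t.
have [c c01] := @MVT R _ _ 0 1 ltr01 (fun t _ => dphi t) (cphi _ _ _ _ dphi).
rewrite subr0 mulr1 scale1r scale0r addr0 => ->.
have c0 : 0 < c by move: c01; rewrite in_itv/= => /andP[].
have [e e01] := @MVT R _ _ 0 c c0 (fun t _ => dpsi t) (cphi _ _ _ _ dpsi).
rewrite {2}/psi scale0r addr0 => ->.
rewrite subr0 normrM.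
have cle1 : `|c| <= 1 by move: c01; rewrite in_itv/= => /andP[? ?]; rewrite ger0_norm ltW.
apply: (@le_trans _ _ (`|J e| * 1)); first exact: ler_wpM2l.
rewrite mulr1 /J.
have Hv i j : `|v ord0 i * (v ord0 j * hessian f (x + e *: v) j i)| <= `|M| * enorm v ^+ 2.
  rewrite !normrM mulrA mulrC; apply: ler_pM => //.
    exact: le_trans (HM _ _ _) (ler_norm _).
  by rewrite expr2; apply: ler_pM => //; exact: coord_le_enorm.
apply: le_trans (ler_norm_sum _ _ _) _.
apply: (@le_trans _ _ (\sum_(i < d) d%:R * `|M| * enorm v ^+ 2)).
  apply: ler_sum => i _; rewrite mulr_sumr.
  apply: le_trans (ler_norm_sum _ _ _) _.
  apply: (@le_trans _ _ (\sum_(j < d) `|M| * enorm v ^+ 2)); first by apply: ler_sum.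
  by rewrite sumr_const card_ord -[leLHS]mulr_natl mulrA.
by rewrite sumr_const card_ord -[leLHS]mulr_natl !mulrA.
Qed.
End taylor.

(** * Kernel smoothing *)

Section smoothing.
Context {R : realType} {d : nat}.
Variable K : 'rV[R]_d -> R.
Hypothesis densK : is_density K.
Implicit Types (f : 'rV[R]_d -> R) (x u y : 'rV[R]_d).

Lemma measurable_scaled_kernel (b : R) x :
  measurable_fun setT (fun y => scaled_kernel K b (x - y)).
Proof.
have [mK _ _] := densK.
apply: measurable_funM => //; apply: measurableT_comp => //.
apply: measurable_fun_rV => i; under eq_fun do rewrite !mxE.
apply: measurable_funM => //; apply: measurable_funB => //.
exact: measurable_coord.
Qed.

Lemma scaled_kernel_ge0 (b : R) u : 0 <= b -> 0 <= scaled_kernel K b u.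
Proof.
by have [_ K0 _] := densK => b0; rewrite divr_ge0 ?exprn_ge0.
Qed.

Lemma integral_scaled_kernel (b : R) x (F : 'rV[R]_d -> \bar R) :
  0 < b -> measurable_fun setT F -> (forall y, 0 <= F y)%E ->
  (\int[lebesgue_rV d]_y (F y * (scaled_kernel K b (x - y))%:E) =
   \int[lebesgue_rV d]_u (F (x - b *: u)%R * (K u)%:E))%E.
Proof.
move=> b0 mF F0; have [mK K0 _] := densK.
rewrite (@ge0_integral_rV_refl_scale _ _ x b (fun y =>
    F y * (scaled_kernel K b (x - y))%:E)%E)//; last 2 first.
- by apply: emeasurable_funM => //; apply/measurable_EFinP; exact: measurable_scaled_kernel.
- by move=> y; rewrite mule_ge0// lee_fin scaled_kernel_ge0// ltW.
have E u : (F (x - b *: u)%R * (scaled_kernel K b (x - (x - b *: u))%R)%:E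
   = (b ^- d)%:E * (F (x - b *: u)%R * (K u)%:E))%E.
  rewrite /scaled_kernel opprB addrCA subrr addr0 scalerA mulVf ?gt_eqF// scale1r.
  by rewrite [X in X%:E]mulrC EFinM muleCA.
under eq_integral do rewrite E.
rewrite ge0_integralZl//; last 3 first.
- apply: emeasurable_funM; last exact/measurable_EFinP.
  exact: (measurableT_comp mF (measurable_rV_refl_scale x b)).
- by move=> u _; rewrite mule_ge0// lee_fin.
- by rewrite lee_fin invr_ge0 exprn_ge0// ltW.
by rewrite muleA -EFinM divff ?expf_neq0 ?gt_eqF// mul1e.
Qed.

Lemma integral_scaled_kernel1 (b : R) x : 0 < b ->
  (\int[lebesgue_rV d]_y (scaled_kernel K b (x - y))%:E = 1)%E.
Proof.
move=> b0; have [_ _ K1] := densK.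
have := @integral_scaled_kernel b x (cst 1%E) b0.
under eq_integral do rewrite mul1e.
move=> ->//; under eq_integral do rewrite mul1e.
by [].
Qed.

Hypothesis K_mean : forall i, (\int[lebesgue_rV d]_u (u ord0 i * K u)%:E = 0)%E.
Hypothesis K_var : (\int[lebesgue_rV d]_u (enorm u ^+ 2 * K u)%:E < +oo)%E.

(** After the substitution, the terms of order 0 and 1 of the expansion of [f] integrate to [f x]
    and 0 against [K]; the remainder is at most a constant times [b^2 |u|^2 K u], whose integral is
    finite. *)
Lemma kernel_bias f : is_density f -> C2 f ->
  (exists M : R, forall x i j, `|hessian f x i j| <= M) ->
  (exists U : R, forall x, f x <= U) ->
  exists2 C : R, 0 <= C & forall (b : R) x, 0 < b ->
   `|fine (\int[lebesgue_rV d]_y (f y * scaled_kernel K b (x - y))%:E) - f x| <= C * b ^+ 2.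
Proof.
move=> [mf f0 f1] C2f hf [U fU].
have [mK K0 K1] := densK.
have [C C0 HC] := taylor2 C2f hf.
pose V := (\int[lebesgue_rV d]_u (enorm u ^+ 2 * K u)%:E)%E.
have Vfin : (V < +oo)%E by exact: K_var.
have V0 : (0 <= V)%E by apply: integral_ge0 => u _; rewrite lee_fin mulr_ge0 ?sqr_ge0.
exists (C * fine V); first by rewrite mulr_ge0// fine_ge0.
move=> b x b0.
pose mu := lebesgue_rV (R:=R) d.
have -> : (\int[mu]_y (f y * scaled_kernel K b (x - y))%:E =
    \int[mu]_u (f (x - b *: u) * K u)%:E)%E.
  under eq_integral do rewrite EFinM.
  rewrite integral_scaled_kernel//; last exact/measurable_EFinP.
have pos u : 0 <= enorm u ^+ 2 * K u by rewrite mulr_ge0 ?sqr_ge0.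
have iV : mu.-integrable setT (fun u => (enorm u ^+ 2 * K u)%:E).
  apply/integrableP; split.
    by apply/measurable_EFinP/measurable_funM => //; apply: measurable_funX;
        exact: measurable_enorm.
  under eq_integral do rewrite abse_EFin (ger0_norm (pos _)).
  exact: K_var.
have iK : mu.-integrable setT (EFin \o K).
  apply/integrableP; split; first exact/measurable_EFinP.
  under eq_integral do rewrite /= ger0_norm//.
  by rewrite K1 ltry.
(* First moments are integrable because [|u_i| <= 1 + |u|^2]. *)
have iu i : mu.-integrable setT (fun u => (u ord0 i * K u)%:E).
  apply: (@le_integrable _ _ _ mu _ measurableT _ (fun u =>
      (K u)%:E + (enorm u ^+ 2 * K u)%:E)%E).
  - by apply/measurable_EFinP/measurable_funM => //; exact: measurable_coord.
  - move=> u _; rewrite -EFinD !abse_EFin lee_fin [leRHS]ger0_norm; last first.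
      by rewrite addr_ge0.
    rewrite normrM (ger0_norm (K0 u)) -{2}[K u]mul1r -mulrDl ler_wpM2r//.
    by apply: le_trans (coord_le_enorm u i) _; have := sqr_ge0 (enorm u - 1); nra.
  - exact: integrableD.
have mfb : measurable_fun setT (fun u => f (x - b *: u)).
  exact: (measurableT_comp mf (measurable_rV_refl_scale x b)).
have ifK : mu.-integrable setT (fun u => (f (x - b *: u) * K u)%:E).
  apply: (@le_integrable _ _ _ mu _ measurableT _ (fun u => (U * K u)%:E)%E).
  - by apply/measurable_EFinP/measurable_funM.
  - move=> u _; rewrite !abse_EFin lee_fin !normrM ler_wpM2r// !ger0_norm//.
    exact: le_trans (f0 0) (fU _).
  - by under eq_fun do rewrite EFinM; exact: integrableZl.
(* The Taylor remainder for the displacement [- b u]; its integral against [K] is exactly the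
   bias. *)
pose T u := f (x - b *: u) - f x + b * \sum_i u ord0 i * gradient f x ord0 i.
have TK : (\int[mu]_u (T u * K u)%:E = \int[mu]_u (f (x - b *: u) * K u)%:E - (f x)%:E)%E.
  have E u : ((T u * K u)%:E = (f (x - b *: u) * K u)%:E + ((- f x)%:E * (K u)%:E +
     \sum_(i < d) (b * gradient f x ord0 i)%:E * (u ord0 i * K u)%:E))%E.
    under eq_bigr do rewrite -EFinM.
    rewrite sumEFin -[X in (_ + (X + _))%E]EFinM -!EFinD; congr EFin.
    rewrite /T !mulrDl -addrA; congr (_ + (_ + _)).
    rewrite -mulrA mulr_suml mulr_sumr; apply: eq_bigr => i _; ring.
  have ig i : mu.-integrable setT (fun u =>
      (b * gradient f x ord0 i)%:E * (u ord0 i * K u)%:E)%E.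
    exact: integrableZl.
  have iS : mu.-integrable setT (fun u =>
      \sum_(i < d) (b * gradient f x ord0 i)%:E * (u ord0 i * K u)%:E)%E.
    by apply: integrable_sum => // i _; exact: ig.
  have iKf : mu.-integrable setT (fun u => (- f x)%:E * (K u)%:E)%E by exact: integrableZl.
  under eq_integral do rewrite E.
  rewrite integralD//; last exact: integrableD.
  rewrite integralD// integralZl// K1 mule1 integral_sum//.
  rewrite big1 ?adde0//.
  by move=> i _; rewrite integralZl// K_mean mule0.
have fin1 : (\int[mu]_u (f (x - b *: u) * K u)%:E)%E \is a fin_num by exact:
    integrable_fin_num.
have mTK : measurable_fun setT (fun u => (T u * K u)%:E).
  apply/measurable_EFinP/measurable_funM => //.
  apply: measurable_funD; first exact: measurable_funB.
  apply: measurable_funM => //; apply: measurable_sum => i.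
  by apply: measurable_funM => //; exact: measurable_coord.
rewrite -lee_fin -abse_EFin EFinB fineK// -TK.
apply: le_trans; first exact: le_abse_integral.
have -> : (C * fine V * b ^+ 2)%:E =
    (\int[mu]_u ((C * b ^+ 2)%:E * (enorm u ^+ 2 * K u)%:E))%E.
  by rewrite integralZl// -/V mulrAC EFinM fineK// ge0_fin_numE.
apply: ge0_le_integral => //.
- exact: measurableT_comp.
- by apply: emeasurable_funM => //; exact: measurable_int iV.
- move=> u _; rewrite abse_EFin -EFinM lee_fin normrM (ger0_norm (K0 u)) mulrA ler_wpM2r//.
  have := HC x (- (b *: u)); rewrite -scaleNr enormZ normrN (ger0_norm (ltW b0)) exprMn
      mulrA.
  rewrite (_ : \sum_i _ = - (b * \sum_i u ord0 i * gradient f x ord0 i)) ?opprK//.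
    by rewrite scaleNr.
  rewrite -mulNr mulr_sumr; apply: eq_bigr => i _; rewrite !mxE; ring.
Qed.

End smoothing.

(** * Consequences of the rate conditions *)

Section asymptotics.
Context {R : realType} (d : nat).
Variables (h lambda : nat -> R) (eps : R).
Hypothesis d_gt0 : (0 < d)%N.
Hypothesis h_gt0 : forall k, (1 <= k)%N -> 0 < h k.
Hypothesis lambda_itv : forall k, (1 <= k)%N -> 0 < lambda k <= 1.
Hypothesis eps_gt0 : 0 < eps.
Hypothesis rate_small : negligible_wrt (fun n => rate d h n + h n ^+ 4)
                   (fun n => lambda n `^ (1 + eps)).
Hypothesis lambda_small : negligible_wrt (fun n => lambda n `^ (1 + eps)) (fun=> 1).

Lemma rate_ge0 n : 0 <= rate d h n.
Proof. exact: sqrtr_ge0. Qed.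

Lemma near_rate_le (c : R) : 0 < c ->
  \forall n \near \oo, rate d h n <= c * lambda n `^ (1 + eps) /\
     h n ^+ 4 <= c * lambda n `^ (1 + eps).
Proof.
move=> c0.
have /cvgrPdist_le /(_ _ c0) [N _ HN] := rate_small.
exists N.+1 => // n /= Nn.
have := HN n (ltnW Nn); rewrite sub0r normrN.
have n1 : (1 <= n)%N by apply: leq_ltn_trans Nn.
have l0 : 0 < lambda n `^ (1 + eps) by apply: powR_gt0; case/andP: (lambda_itv n1).
have a0 := rate_ge0 n.
have h0 : 0 <= h n ^+ 4 by rewrite exprn_ge0// ltW// h_gt0.
rewrite ger0_norm; last by rewrite divr_ge0 ?addr_ge0// ltW.
by rewrite ler_pdivrMr// => H; split; lra.
Qed.

Lemma near_lambda_le (c : R) : 0 < c -> \forall n \near \oo, lambda n <= c.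
Proof.
move=> c0.
have c1 : 0 < c `^ (1 + eps) by exact: powR_gt0.
have /cvgrPdist_lt /(_ _ c1) [N _ HN] := lambda_small.
exists N.+1 => // n /= Nn.
have := HN n (ltnW Nn); rewrite sub0r normrN divr1 ger0_norm ?powR_ge0//.
have n1 : (1 <= n)%N by apply: leq_ltn_trans Nn.
have /andP[l0 _] := lambda_itv n1.
apply: contraTT; rewrite -ltNge -leNgt => H.
have e0 : 0 <= 1 + eps by rewrite addr_ge0// ltW.
by apply: (ge0_ler_powR e0); rewrite ?nnegrE; exact: ltW.
Qed.

Lemma near_ln_ge1 : \forall n \near \oo, 1 <= ln n%:R :> R.
Proof.
exists (Num.truncn (expR 1 : R)).+1 => // n /= Nn.
have H : expR 1 <= n%:R :> R.
  by apply: ltW; apply: lt_le_trans (truncnS_gt _) _; rewrite ler_nat.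
have n0 : 0 < n%:R :> R by exact: lt_le_trans (expR_gt0 1) H.
by rewrite -[leLHS]expRK ler_ln ?posrE ?expR_gt0.
Qed.

Lemma lambda_powR_le n : (1 <= n)%N -> lambda n `^ (1 + eps) <= lambda n.
Proof.
by move=> /lambda_itv l; apply: ge1r_powR => //; rewrite lerDl ltW.
Qed.

(** Everything comes from [rate <= lambda^(1 + eps) <= lambda <= 1]. That the rate is at most 1
    means [ln n <= n h^d], so [1 / h^d <= n], and [1 / h <= n] since [h^d <= h] in positive
    dimension. Conversely [ln n >= 1] and [h^d <= 1] keep the rate above [1 / n], so
    [1 / lambda <= n]. These polynomial bounds are what a polynomially fine grid can absorb. *)
Lemma near_regime : \forall n \near \oo,
  [/\ [/\ (3 <= n)%N, 1 <= ln n%:R :> R & h n <= 1],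
      [/\ rate d h n <= lambda n `^ (1 + eps), h n ^+ 4 <= lambda n `^ (1 + eps)
         & n%:R^-1 <= rate d h n] &
      [/\ (lambda n)^-1 <= n%:R, (h n ^+ d)^-1 <= n%:R & (h n)^-1 <= n%:R]].
Proof.
have [N1 _ H1] := near_rate_le ltr01.
have [N2 _ H2] := near_ln_ge1.
exists (N1 + N2 + 3)%N => // n /= Nn.
have [ra hl] : rate d h n <= lambda n `^ (1 + eps) /\ h n ^+ 4 <= lambda n `^ (1 + eps).
  by have := H1 n; rewrite /= !mul1r; apply; lia.
have ln1 : 1 <= ln n%:R :> R by apply: H2 => /=; lia.
have n1 : (1 <= n)%N by lia.
have /andP[l0 l1] := lambda_itv n1.
have lp := lambda_powR_le n1.
have h0 := h_gt0 n1.
have h1 : h n <= 1.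
  by rewrite -(@expr_le1 _ 4)// ?(ltW h0)//; apply: le_trans hl _; exact: le_trans lp _.
have n0 : 0 < n%:R :> R by rewrite ltr0n.
have hd0 : 0 < h n ^+ d by rewrite exprn_gt0.
have hd1 : h n ^+ d <= 1 by rewrite exprn_ile1// ltW.
have a2 : rate d h n ^+ 2 = ln n%:R / (n%:R * h n ^+ d).
  by rewrite sqr_sqrtr// divr_ge0 ?mulr_ge0 ?ltW//; lra.
have a1 : rate d h n <= 1 by apply: le_trans ra _; exact: le_trans lp _.
have a21 : rate d h n ^+ 2 <= 1 by rewrite expr_le1// rate_ge0.
have hdn : (h n ^+ d)^-1 <= n%:R.
  rewrite -[leLHS]div1r ler_pdivrMr//.
  move: a21; rewrite a2 ler_pdivrMr ?mulr_gt0// mul1r; exact: le_trans.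
have na : n%:R^-1 <= rate d h n.
  rewrite -(@ler_pXn2r _ 2)// ?nnegrE ?invr_ge0 ?rate_ge0// a2.
  have nh0 : 0 < n%:R * h n ^+ d by rewrite mulr_gt0.
  apply: (@le_trans _ _ (n%:R * h n ^+ d)^-1).
    rewrite exprVn lef_pV2 ?posrE ?exprn_gt0// expr2 ler_pM2l//.
    by apply: le_trans hd1 _; rewrite ler1n.
  by rewrite ler_peMl// invr_ge0 ltW.
have lan : n%:R^-1 <= lambda n by apply: le_trans na _; exact: le_trans lp.
have hn : h n ^+ d <= h n.
  by case: (d) d_gt0 => // d' _; rewrite exprS ger_pMr// exprn_ile1// ltW.
have n3 : (3 <= n)%N by apply: leq_trans Nn; rewrite leq_addl.
have ln' : (lambda n)^-1 <= n%:R by rewrite -[leRHS]invrK lef_pV2 ?posrE ?invr_gt0.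
have hn' : (h n)^-1 <= n%:R by apply: le_trans hdn; rewrite lef_pV2 ?posrE.
exact: (And3 (And3 n3 ln1 h1) (And3 ra hl na) (And3 ln' hdn hn')).
Qed.

End asymptotics.

(** * Kernel bounds and grid *)

Lemma polynomial_decay_far (R : realType) (d : nat) (g : 'rV[R]_d -> R) :
  polynomial_decay g -> exists C r : R, [/\ 0 < C, 0 < r &
    forall s x, 0 < s -> s <= enorm x -> g x <= C * s `^ (- r)].
Proof.
move=> [C [r [C0 r0 H]]]; exists C, r; split => // s x s0 sx.
apply: le_trans (H x) _; rewrite ler_pM2l// !powRN lef_pV2 ?posrE ?powR_gt0//.
  by apply: (ge0_ler_powR (ltW r0));
      rewrite ?nnegrE ?addr_ge0 ?enorm_ge0 ?(ltW s0)// (le_trans sx)// lerDr.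
by rewrite ltr_pwDl// enorm_ge0.
Qed.

Section kernel_bounds.
Context {R : realType} {d : nat}.
Variables (K : 'rV[R]_d -> R) (Kmax Lip : R).
Hypothesis K_dens : is_density K.
Hypothesis K_max : forall x, K x <= Kmax.
Hypothesis K_lip : forall x y, `|K x - K y| <= Lip * enorm (x - y).
Implicit Types (b : R) (x y u : 'rV[R]_d).

Lemma scaled_kernel_le b u : 0 < b -> scaled_kernel K b u <= Kmax / b ^+ d.
Proof. by move=> b0; rewrite ler_pM2r ?invr_gt0 ?exprn_gt0. Qed.

Lemma scaled_kernel_lip b x y : 0 < b ->
  `|scaled_kernel K b x - scaled_kernel K b y| <= Lip / b ^+ d.+1 * enorm (x - y).
Proof.
move=> b0; rewrite /scaled_kernel -mulrBl normrM [X in _ * X]ger0_norm; last first.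
  by rewrite invr_ge0 exprn_ge0// ltW.
rewrite exprS invfM mulrA -mulrA [_ * enorm _]mulrC mulrA.
rewrite ler_pM2r ?invr_gt0 ?exprn_gt0//.
apply: le_trans (K_lip _ _) _.
by rewrite -scalerBr enormZ ger0_norm ?invr_ge0 ?(ltW b0)// mulrA.
Qed.

(** One kernel factor is bounded by its supremum and the other integrates to 1. This is the source
    of the [1 / h^d] in the variance. *)
Lemma integral_mul_scaled_kernel_sqr (u : 'rV[R]_d -> R) (U b : R) x :
  measurable_fun setT u -> (forall y, 0 <= u y <= U) -> 0 < b ->
  (\int[lebesgue_rV d]_y (u y * scaled_kernel K b (x - y) ^+ 2)%:E
     <= (U * Kmax / b ^+ d)%:E)%E.
Proof.
move=> mu uU b0.
have bd0 : 0 < b ^+ d by rewrite exprn_gt0.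
have U0 : 0 <= U by have /andP[] := uU 0; exact: le_trans.
have Km0 : 0 <= Kmax by have [_ K0 _] := K_dens; exact: le_trans (K0 0) (K_max 0).
have msk := measurable_scaled_kernel K_dens b x.
apply: (@le_trans _ _ (\int[lebesgue_rV d]_y ((U * Kmax / b ^+ d)%:E * (scaled_kernel K
    b (x - y))%:E))%E).
  apply: ge0_le_integral => //.
  - by move=> y _; rewrite lee_fin mulr_ge0 ?sqr_ge0//; have /andP[] := uU y.
  - apply/measurable_EFinP/measurable_funM => //; exact: measurable_funX.
  - by apply: emeasurable_funM => //; exact/measurable_EFinP.
  - move=> y _; rewrite -EFinM lee_fin expr2 mulrA.
    have sk0 : 0 <= scaled_kernel K b (x - y) by apply: scaled_kernel_ge0 => //; exact: ltW.
    rewrite ler_wpM2r// -[leRHS]mulrA; apply: ler_pM => //.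
    + by have /andP[] := uU y.
    + by have /andP[] := uU y.
    + exact: scaled_kernel_le.
rewrite ge0_integralZl//.
- by rewrite integral_scaled_kernel1// mule1.
- exact/measurable_EFinP.
- by move=> y _; rewrite lee_fin scaled_kernel_ge0// ltW.
- by rewrite lee_fin divr_ge0 ?mulr_ge0// ltW.
Qed.

Lemma integral_scaled_kernel_lip (f : 'rV[R]_d -> R) b x y : is_density f -> 0 < b ->
  `|fine (\int[lebesgue_rV d]_z (f z * scaled_kernel K b (x - z))%:E) -
    fine (\int[lebesgue_rV d]_z (f z * scaled_kernel K b (y - z))%:E)|
  <= Lip / b ^+ d.+1 * enorm (x - y).
Proof.
move=> [mf f0 f1] b0; set D := Lip / _ * _.
have D0 : 0 <= D by apply: le_trans (scaled_kernel_lip x y b0).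
have bd0 : 0 < b ^+ d by rewrite exprn_gt0.
have Km0 : 0 <= Kmax by have [_ K0 _] := K_dens; exact: le_trans (K0 0) (K_max 0).
have mfs u : measurable_fun setT (fun z => (f z * scaled_kernel K b (u - z))%:E).
  apply/measurable_EFinP/measurable_funM => //; exact: measurable_scaled_kernel.
have fs0 u z : 0 <= f z * scaled_kernel K b (u - z).
  by rewrite mulr_ge0// scaled_kernel_ge0// ltW.
pose J u := (\int[lebesgue_rV d]_z (f z * scaled_kernel K b (u - z))%:E)%E.
have cf c : (\int[lebesgue_rV d]_z (f z * c)%:E = c%:E)%E.
  under eq_integral do rewrite mulrC EFinM.
  by rewrite integralZl// ?f1 ?mule1//; apply/integrableP; split;
    [exact/measurable_EFinP|under eq_integral do rewrite abse_EFin ger0_norm//;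
        rewrite f1 ltry].
have Jfin u : J u \is a fin_num.
  rewrite ge0_fin_numE; last by apply: integral_ge0 => z _; rewrite lee_fin.
  apply: (@le_lt_trans _ _ (Kmax / b ^+ d)%:E); last exact: ltry.
  rewrite -cf; apply: ge0_le_integral => //.
  - by move=> z _; rewrite lee_fin.
  - by apply/measurable_EFinP/measurable_funM.
  - by move=> z _; rewrite lee_fin ler_wpM2l// scaled_kernel_le.
have JJ u v : (forall z, scaled_kernel K b (u - z) <= scaled_kernel K b (v - z) + D) ->
  fine (J u) <= fine (J v) + D.
  move=> H; rewrite -lee_fin EFinD !fineK// -[D%:E]cf -ge0_integralD//; last 3 first.
  - by move=> z _; rewrite lee_fin.
  - by move=> z _; rewrite lee_fin mulr_ge0.
  - by apply/measurable_EFinP/measurable_funM.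
  apply: ge0_le_integral => //.
  - by move=> z _; rewrite lee_fin.
  - by apply: emeasurable_funD => //; apply/measurable_EFinP/measurable_funM.
  - by move=> z _; rewrite -EFinD lee_fin -mulrDr ler_wpM2l.
have Dz z : `|scaled_kernel K b (x - z) - scaled_kernel K b (y - z)| <= D.
  apply: le_trans (scaled_kernel_lip _ _ b0) _.
  by rewrite opprB addrA subrK.
have h1 : fine (J x) <= fine (J y) + D.
  by apply: JJ => z; have := Dz z; rewrite ler_norml => /andP[]; lra.
have h2 : fine (J y) <= fine (J x) + D.
  by apply: JJ => z; have := Dz z; rewrite ler_norml => /andP[]; lra.
by rewrite -/(J x) -/(J y) ler_norml; apply/andP; split; lra.
Qed.

End kernel_bounds.

Section grid.
Context {R : realType} {d : nat}.

(** The box has half-width [n^p] and the mesh is [n^-p], whence [2 n^(2 p) + 1] values per axis. A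
    single exponent serves the decay outside the box and the Lipschitz bound inside. *)
Definition grid_index (n p : nat) : finType := {ffun 'I_d -> 'I_(2 * n ^ (2 * p)).+1}.

Definition grid_point (n p : nat) (t : grid_index n p) : 'rV[R]_d :=
  \row_j ((t j)%:R / n%:R ^+ p - n%:R ^+ p).

Lemma card_grid_index n p : (0 < n)%N -> (#|grid_index n p| <= 3 ^ d * n ^ (2 * p * d))%N.
Proof.
move=> n0; rewrite card_ffun !card_ord [(n ^ (2 * p * d))%N]expnM -expnMn.
case: (d) => // d'; rewrite leq_exp2r// -[X in (X <= _)%N]addn1 mulSn addnC leq_add//.
by rewrite expn_gt0 n0.
Qed.

Lemma grid_near n p (x : 'rV[R]_d) : (0 < n)%N ->
  (forall j, `|x ord0 j| <= n%:R ^+ p) ->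
  exists t : grid_index n p, forall j, `|(x - grid_point t) ord0 j| <= n%:R ^- p.
Proof.
move=> n0 H.
have np0 : 0 < n%:R ^+ p :> R by rewrite exprn_gt0// ltr0n.
have y0 j : 0 <= (x ord0 j + n%:R ^+ p) * n%:R ^+ p.
  by rewrite mulr_ge0 ?(ltW np0)//; have := H j; rewrite ler_norml => /andP[]; lra.
have ylt j : (Num.truncn ((x ord0 j + n%:R ^+ p) * n%:R ^+ p) < (2 * n ^ (2 * p)).+1)%N.
  have tl : (Num.truncn ((x ord0 j + n%:R ^+ p) * n%:R ^+ p))%:R <=
      (x ord0 j + n%:R ^+ p) * n%:R ^+ p :> R.
    by rewrite truncn_le.
  rewrite ltnS -(ler_nat R); apply: le_trans tl _; rewrite natrM natrX exprM.
  apply: (@le_trans _ _ ((n%:R ^+ p + n%:R ^+ p) * n%:R ^+ p)).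
    by rewrite ler_pM2r// lerD2r; have := H j; rewrite ler_norml => /andP[].
  rewrite exprAC; set z := _ ^+ p.
  by have -> : (z + z) * z = 2 * z ^+ 2 by ring.
exists [ffun j => Ordinal (ylt j)] => j.
rewrite !mxE ffunE/=.
have /andP[h1 h2] := truncn_itv (y0 j); move: h1 h2; set t := Num.truncn _ => h1 h2.
rewrite -(@ler_pM2r _ (n%:R ^+ p))// mulVf ?gt_eqF// -[X in _ * X](ger0_norm (ltW np0))
    -normrM.
rewrite mulrBl mulrBl divfK ?gt_eqF// ler_norml.
move: h1 h2; rewrite -natr1 mulrDl => h1 h2; apply/andP; split; lra.
Qed.
End grid.

(** * The mixture policy *)

Lemma polynomial_decay_bounded (R : realType) (d : nat) (g : 'rV[R]_d -> R) :
  polynomial_decay g -> exists2 U : R, 0 < U & forall x, g x <= U.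
Proof.
move=> [C [r [C0 r0 H]]]; exists C => // x.
apply: le_trans (H x) _; rewrite ger_pMr//.
rewrite -[leRHS](powRr0 (1 + enorm x)); apply: ler_powR; last by rewrite oppr_le0 ltW.
by rewrite lerDl enorm_ge0.
Qed.

(** Any [p > 3 / r] works. The cube pays for the factors [1 / lambda <= n] and [1 / h^d <= n] and
    still leaves [1 / n]; the half appears because a far point [x] forces either [y] or [x - y] to
    be at least half as far. *)
Lemma powR_half_pow_le (R : realType) (r : R) : 0 < r ->
  exists p0 : nat, forall p n : nat, (p0 <= p)%N -> (0 < n)%N ->
    (n%:R ^+ p / 2) `^ (- r) <= (2^-1 `^ (- r)) * n%:R ^- 3.
Proof.
move=> r0; exists (Num.truncn (3 / r)).+1 => p n pp n0.
have n0' : 0 < n%:R :> R by rewrite ltr0n.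
have n1' : 1 <= n%:R :> R by rewrite ler1n.
rewrite powRM ?exprn_ge0// mulrC ler_pM2l ?powR_gt0// -powR_mulrn// -powRrM.
rewrite -[X in _ <= X^-1]powR_mulrn// -powRN; apply: ler_powR => //.
rewrite mulrN lerN2.
have : 3 / r < p%:R by apply: lt_le_trans (truncnS_gt _) _; rewrite ler_nat.
by rewrite ltr_pdivrMr// => /ltW.
Qed.

Section mixture_policy.
Context {R : realType} {d : nat} {dO : measure_display}
  {Omega : measurableType dO} {P : probability Omega R}.
Variable X : nat -> {RV P >-> 'rV[R]_d}.
Variable q : nat -> Omega -> 'rV[R]_d -> R.
Variables (f q0 K : 'rV[R]_d -> R) (h lambda : nat -> R).
Hypothesis polq : is_policy X q.
Hypothesis f_dens : is_density f.
Hypothesis q0_dens : is_density q0.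
Hypothesis K_dens : is_density K.
Hypothesis f_pow : forall eta : R, 0 < eta <= 1 ->
  exists2 c : R, 0 < c & forall x, f x `^ eta <= c * q0 x.
Hypothesis h_gt0 : forall k, (1 <= k)%N -> 0 < h k.
Hypothesis lambda_itv : forall k, (1 <= k)%N -> 0 < lambda k <= 1.
Hypothesis lambda_nincr : forall j k, (1 <= j)%N -> (j <= k)%N -> lambda k <= lambda j.
Hypothesis q_0 : forall w, q 0%N w = q0.
Hypothesis q_mixture : forall k w x, (1 <= k)%N ->
    q k w x = (1 - lambda k) * wkde X q f K h k w x + lambda k * q0 x.
Implicit Types (x y : 'rV[R]_d) (w : Omega).

(** * Bounds on the importance ratio *)

Lemma f_ge0 x : 0 <= f x. Proof. by have [] := f_dens. Qed.
Lemma q0_ge0 x : 0 <= q0 x. Proof. by have [] := q0_dens. Qed.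
Lemma q_ge0 k w x : 0 <= q k w x.
Proof. by have [q1 _ _] := polq; have [] := q1 k w. Qed.

Lemma weight_ge0 k w : 0 <= weight X q f k w.
Proof. by rewrite /weight divr_ge0 ?f_ge0 ?q_ge0. Qed.

Lemma nweight_ge0 n k w : 0 <= nweight X q f n k w.
Proof.
rewrite /nweight; case: ifP => _; first by rewrite invr_ge0.
by rewrite divr_ge0 ?weight_ge0// sumr_ge0// => i _; exact: weight_ge0.
Qed.

Lemma wkde_ge0 n w x : (1 <= n)%N -> 0 <= wkde X q f K h n w x.
Proof.
move=> n1; apply: sumr_ge0 => i _; rewrite mulr_ge0 ?nweight_ge0//.
by apply: scaled_kernel_ge0 => //; rewrite ltW// h_gt0.
Qed.

(** Monotonicity of [lambda] gives one lower bound valid for all steps up to [n]; step 0, which is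
    not a mixture, is covered because [lambda n <= 1]. *)
Lemma q_ge n k w x : (1 <= n)%N -> (k <= n)%N -> lambda n * q0 x <= q k w x.
Proof.
move=> n1; have /andP[ln0 ln1] := lambda_itv n1.
case: k => [_|k kn]; first by rewrite q_0 ler_piMl ?q0_ge0.
rewrite q_mixture//; have /andP[l0 l1] := @lambda_itv k.+1 isT.
apply: (@le_trans _ _ (lambda k.+1 * q0 x)).
  by rewrite ler_wpM2r ?q0_ge0// lambda_nincr.
by rewrite lerDr mulr_ge0 ?wkde_ge0// subr_ge0.
Qed.

(** The safe component dominates [f] up to a constant, so [f] vanishes wherever [q k] does. Division
    by zero thus loses no mass and the weights are exactly unbiased. *)
Lemma f_eq0 k w x : q k w x = 0 -> f x = 0.
Proof.
move=> q00; have [|c c0 H] := f_pow (eta := 1); first by rewrite ltr01 lexx.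
have := @q_ge k.+1 k w x isT (leqnSn k); rewrite q00 => H2.
have := H x; rewrite powRr1 ?f_ge0// => H3.
have /andP[l0 _] := @lambda_itv k.+1 isT.
have q00' : q0 x = 0.
  by apply/eqP; rewrite eq_le q0_ge0 andbT -(pmulr_rle0 _ l0).
by apply/eqP; rewrite eq_le f_ge0 andbT; rewrite q00' mulr0 in H3.
Qed.

Lemma ratioMq k w x : f x / q k w x * q k w x = f x.
Proof.
have [/f_eq0 f0|q0'] := eqVneq (q k w x) 0; first by rewrite f0 !mul0r.
by rewrite divfK.
Qed.

Lemma ratio_ge0 k w x : 0 <= f x / q k w x.
Proof. by rewrite divr_ge0 ?f_ge0 ?q_ge0. Qed.

(** Write [f = f^(1 - eta) f^eta] and absorb [f^eta] in [q0]. Taking [eta = 1] bounds the weights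
    uniformly; a smaller [eta] keeps a power of [f], which supplies smallness where [f] is small. *)
Lemma ratio_le (eta c : R) n k w x : 0 < eta <= 1 -> 0 < c ->
  (forall x, f x `^ eta <= c * q0 x) -> (1 <= n)%N -> (k <= n)%N ->
  f x / q k w x <= c / lambda n * f x `^ (1 - eta).
Proof.
move=> /andP[e0 e1] c0 H n1 kn.
have /andP[l0 _] := lambda_itv n1.
have rhs0 : 0 <= c / lambda n * f x `^ (1 - eta).
  by rewrite mulr_ge0 ?powR_ge0// divr_ge0 ?(ltW c0) ?(ltW l0).
have := f_ge0 x; rewrite le_eqVlt => /predU1P[f0|f0];
    first by rewrite -[X in X / _]f0 mul0r.
have := q_ge0 k w x; rewrite le_eqVlt => /predU1P[q00|qp].
  by rewrite -q00 invr0 mulr0.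
rewrite ler_pdivrMr//.
have fE : f x = f x `^ (1 - eta) * f x `^ eta.
  by rewrite -powRD ?subrK ?powRr1 ?(ltW f0)//; apply/implyP => _; exact: lt0r_neq0.
rewrite [leLHS]fE (_ : c / lambda n * _ * _ =
    f x `^ (1 - eta) * (c * (q k w x / lambda n))); last by ring.
apply: ler_wpM2l; first exact: powR_ge0.
apply: le_trans (H x) _; rewrite ler_pM2l// ler_pdivlMr// mulrC.
exact: q_ge.
Qed.

(** * Weighted sums and their quadratic variation *)

Definition increment (phi : 'rV[R]_d -> R) k w x : R := f x / q k w x * phi x.

Definition weighted_sum (phi : 'rV[R]_d -> R) n w : R :=
  \sum_(k < n) increment phi k w (X k.+1 w).

Section increment.
Variable phi : 'rV[R]_d -> R.
Hypotheses (mphi : measurable_fun setT phi) (phi0 : forall x, 0 <= phi x).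

Lemma increment_ge0 k w x : 0 <= increment phi k w x.
Proof. by rewrite mulr_ge0 ?ratio_ge0. Qed.

Lemma measurable_increment k :
  measurable_fun [set: g_sigma_algebraType (history X k) * 'rV[R]_d]
    (fun z => increment phi k z.1 z.2).
Proof.
have [_ mq _] := polq; have [mf _ _] := f_dens.
apply: measurable_funM; last exact: measurableT_comp.
apply: measurable_funM; first exact: measurableT_comp.
under eq_fun do rewrite -powR_inv1 ?q_ge0//.
apply: (measurableT_comp (measurable_powR (-1))); exact: mq.
Qed.

Lemma cond_moment_increment1 k w : cond_moment q (increment phi) 1 k w =
  fine (\int[lebesgue_rV d]_x (f x * phi x)%:E).
Proof.
congr fine; apply: eq_integral => x _; congr EFin.
by rewrite expr1 /increment mulrAC ratioMq.
Qed.

Lemma deviation_increment n w : deviation X q (increment phi) n w =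
  weighted_sum phi n w - n%:R * fine (\int[lebesgue_rV d]_x (f x * phi x)%:E).
Proof.
rewrite /deviation sumrB; congr (_ - _).
under eq_bigr do rewrite cond_moment_increment1.
by rewrite sumr_const card_ord mulr_natl.
Qed.

(** The conditional second moment is the integral of [(f^2 / q_k) phi^2]; summing under the integral
    sign requires only a pointwise bound on the sum over [k], not on each term. *)
Lemma quad_var_increment_le (u : 'rV[R]_d -> R) (c B : R) n w :
  measurable_fun setT u -> (forall x, 0 <= u x) -> 0 <= c ->
  (forall x, \sum_(k < n) f x * (f x / q k w x) <= c * u x) ->
  (\int[lebesgue_rV d]_x (u x * phi x ^+ 2)%:E <= B%:E)%E ->
  quad_var q (increment phi) n w <= c * B.
Proof.
move=> mu u0 c0 H HB.
have [q1 _ _] := polq; have [mf _ _] := f_dens.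
pose F (k : nat) x := f x * (f x / q k w x) * phi x ^+ 2.
have mF k : measurable_fun setT (fun x => (F k x)%:E).
  apply/measurable_EFinP; apply: measurable_funM; last exact: measurable_funX.
  apply: measurable_funM => //; apply: measurable_funM => //.
  under eq_fun do rewrite -powR_inv1 ?q_ge0//.
  apply: (measurableT_comp (measurable_powR (-1))); by have [] := q1 k w.
have F0 k x : 0 <= F k x by rewrite mulr_ge0 ?sqr_ge0// mulr_ge0 ?f_ge0 ?ratio_ge0.
have E k : cond_moment q (increment phi) 2 k w = fine (\int[lebesgue_rV d]_x (F k x)%:E).
  congr fine; apply: eq_integral => x _; congr EFin.
  rewrite /F /increment -{2}(ratioMq k w x); set r := f x / q k w x; ring.
have S : (\sum_(k < n) \int[lebesgue_rV d]_x (F k x)%:E <= (c * B)%:E)%E.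
  rewrite -ge0_integral_sum//; last by move=> k x _; rewrite lee_fin.
  apply: (@le_trans _ _ (\int[lebesgue_rV d]_x (c%:E * (u x * phi x ^+ 2)%:E))%E).
    apply: ge0_le_integral => //.
    - by move=> x _; rewrite sume_ge0// => k _; rewrite lee_fin.
    - by apply: emeasurable_sum => k.
    - apply: emeasurable_funM => //; apply/measurable_EFinP/measurable_funM => //.
      exact: measurable_funX.
    - move=> x _; rewrite sumEFin -EFinM lee_fin /F -mulr_suml [leRHS]mulrA.
      by rewrite ler_wpM2r ?sqr_ge0.
  rewrite ge0_integralZl//; last 2 first.
  - apply/measurable_EFinP/measurable_funM => //; exact: measurable_funX.
  - by move=> x _; rewrite lee_fin mulr_ge0 ?sqr_ge0.
  by rewrite EFinM lee_wpmul2l// lee_fin.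
rewrite -lee_fin /quad_var -sumEFin; apply: le_trans S.
apply: lee_sum => k _; rewrite E.
(* [fine] sends an infinite value to 0, so it never exceeds a nonnegative integral, finite or
   not. *)
have : (0 <= \int[lebesgue_rV d]_x (F k x)%:E)%E.
  by apply: integral_ge0 => x _; rewrite lee_fin.
by case: (\int[_]_x _)%E => //= _; rewrite leey.
Qed.
End increment.

Lemma weighted_sum_cst1 n w :
  weighted_sum (cst 1) n w = \sum_(k < n) f (X k.+1 w) / q k w (X k.+1 w).
Proof. by apply: eq_bigr => k _; rewrite /increment mulr1. Qed.

Lemma wkde_weighted_sum n w x : weighted_sum (cst 1) n w != 0 ->
  wkde X q f K h n w x =
  weighted_sum (fun y => scaled_kernel K (h n) (x - y)) n w / weighted_sum (cst 1) n w.
Proof.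
rewrite weighted_sum_cst1 => S0.
have SE : \sum_(1 <= j < n.+1) weight X q f j w =
    \sum_(k < n) f (X k.+1 w) / q k w (X k.+1 w).
  by rewrite big_add1 big_mkord.
rewrite /wkde big_add1 big_mkord /weighted_sum mulr_suml; apply: eq_bigr => k _.
by rewrite /nweight SE (negbTE S0) /increment /weight/= mulrAC.
Qed.

(** * From grid points to all of space, along one path *)

Variables (Kmax Lip Cb : R).
Hypothesis K_max : forall x, K x <= Kmax.
Hypothesis K_lip : forall x y, `|K x - K y| <= Lip * enorm (x - y).
Hypothesis Lip_ge0 : 0 <= Lip.
Hypothesis K_decay : polynomial_decay K.
Hypothesis q0_decay : polynomial_decay q0.
Hypothesis bias : forall (b : R) x, 0 < b ->
   `|fine (\int[lebesgue_rV d]_y (f y * scaled_kernel K b (x - y))%:E) - f x| <=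
       Cb * b ^+ 2.

Let Kmax_ge0 : 0 <= Kmax.
Proof. by have [_ K0 _] := K_dens; exact: le_trans (K0 0) (K_max 0). Qed.

Lemma far_bound : exists p0 : nat, exists2 C : R, 0 <= C &
  forall p n k w x y (b : R) j, (p0 <= p)%N -> (0 < n)%N -> (k <= n)%N ->
    0 < b -> b <= 1 -> (lambda n)^-1 <= n%:R -> (b ^+ d)^-1 <= n%:R ->
    n%:R ^+ p < `|x ord0 j| ->
    f x <= C / n%:R /\ f y / q k w y * scaled_kernel K b (x - y) <= C / n%:R.
Proof.
have [|c1 c10 H1] := f_pow (eta := 1); first by rewrite ltr01 lexx.
have e2 : 0 < (2^-1 : R) <= 1 by apply/andP; split; lra.
have [c2 c20 H2] := f_pow e2.
have [CK [rK [CK0 rK0 HK]]] := polynomial_decay_far K_decay.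
have [C0 [r0 [C00 r00 Hq]]] := polynomial_decay_far q0_decay.
have [p1 P1] := powR_half_pow_le rK0.
have [p2 P2] := powR_half_pow_le r00.
have r02 : 0 < r0 / 2 by rewrite divr_gt0.
have [p3 P3] := powR_half_pow_le r02.
pose A1 : R := 2^-1 `^ (- rK); pose A2 : R := 2^-1 `^ (- r0);
    pose A3 : R := 2^-1 `^ (- (r0 / 2)).
have A10 : 0 <= A1 by exact: powR_ge0.
have A20 : 0 <= A2 by exact: powR_ge0.
have A30 : 0 <= A3 by exact: powR_ge0.
pose D1 := c1 * C0 * A2.
pose D2 := c2 * (c1 * C0) `^ 2^-1 * A3 * Kmax.
pose D3 := c1 * (CK * A1).
have D10 : 0 <= D1 by rewrite !mulr_ge0// ltW.
have D20 : 0 <= D2 by rewrite !mulr_ge0 ?powR_ge0// ltW.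
have D30 : 0 <= D3 by rewrite !mulr_ge0// ltW.
exists (p1 + p2 + p3)%N, (D1 + D2 + D3); first by rewrite !addr_ge0.
move=> p n k w x y b j pp n0 kn b0 b1 ln bn xj.
have n0' : 0 < n%:R :> R by rewrite ltr0n.
have n1' : 1 <= n%:R :> R by rewrite ler1n.
have np0 : 0 < n%:R ^+ p / 2 :> R by rewrite divr_gt0 ?exprn_gt0.
have /andP[l0 _] := lambda_itv n0.
have {}P1 := P1 p n (leq_trans (leq_trans (leq_addr _ _) (leq_addr _ _)) pp) n0.
have {}P2 := P2 p n (leq_trans (leq_trans (leq_addl _ _) (leq_addr _ _)) pp) n0.
have {}P3 := P3 p n (leq_trans (leq_addl _ _) pp) n0.
have n3 : 0 < n%:R ^- 3 :> R by rewrite invr_gt0 exprn_gt0.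
have n31 : n%:R ^- 3 <= n%:R^-1 :> R by rewrite lef_pV2 ?posrE ?exprn_gt0// exprS
    ler_peMr// ?expr_ge1// ltW.
have nn3 : n%:R * n%:R * n%:R ^- 3 = n%:R^-1 :> R.
  by rewrite !exprS expr0 mulr1; field; rewrite gt_eqF.
have fle z : n%:R ^+ p / 2 <= enorm z -> f z <= c1 * C0 * (n%:R ^+ p / 2) `^ (- r0).
  move=> Hz; have := H1 z; rewrite powRr1 ?f_ge0// => /le_trans; apply.
  by rewrite -mulrA ler_pM2l//; exact: Hq.
split.
  have Hx : n%:R ^+ p / 2 <= enorm x.
    apply: le_trans (coord_le_enorm x j); apply: le_trans (ltW xj).
    by rewrite ler_pdivrMr// ler_peMr ?exprn_ge0// ler1n.
  apply: le_trans (fle _ Hx) _.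
  apply: (@le_trans _ _ (c1 * C0 * (A2 * n%:R^-1))).
    rewrite ler_wpM2l ?mulr_ge0 ?(ltW c10) ?(ltW C00)//.
    by apply: le_trans P2 _; rewrite ler_wpM2l.
  by rewrite mulrA -/D1 ler_wpM2r ?invr_ge0// -addrA lerDl addr_ge0.
have sk0 u : 0 <= scaled_kernel K b u by apply: scaled_kernel_ge0 => //; exact: ltW.
(* If [y] is far out, the weight is tiny: the exponent 1/2 in [ratio_le] leaves a square root of
   [f y]. Otherwise [x - y] is large and the kernel is tiny, so the uniform bound on the weight
   suffices. *)
have [yj|yj] := leP (n%:R ^+ p / 2) `|y ord0 j|.
  have Hy : n%:R ^+ p / 2 <= enorm y by apply: le_trans (coord_le_enorm y j).
  apply: (@le_trans _ _ (c2 * n%:R * ((c1 * C0) `^ 2^-1 * (A3 * n%:R ^- 3)) * (Kmax *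
      n%:R))).
    apply: ler_pM => //; first exact: ratio_ge0.
      apply: le_trans (ratio_le w y e2 c20 H2 n0 kn) _.
      apply: ler_pM; rewrite ?powR_ge0 ?divr_ge0 ?(ltW c20) ?(ltW l0)//.
        by rewrite ler_pM2l.
      rewrite (_ : 1 - 2^-1 = 2^-1); last by field.
      apply: (@le_trans _ _ ((c1 * C0 * (n%:R ^+ p / 2) `^ (- r0)) `^ 2^-1)).
        apply: ge0_ler_powR; rewrite ?nnegrE ?f_ge0 ?invr_ge0//; last exact: fle.
        by rewrite mulr_ge0 ?powR_ge0// mulr_ge0// ltW.
      rewrite powRM ?powR_ge0 ?mulr_ge0 ?(ltW c10) ?(ltW C00)// -powRrM mulNr.
      by rewrite ler_wpM2l ?powR_ge0.
    apply: le_trans (scaled_kernel_le K_max _ b0) _.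
    by rewrite ler_wpM2l.
  rewrite (_ : _ * _ = D2 * (n%:R * n%:R * n%:R ^- 3)); last by rewrite /D2; ring.
  by rewrite nn3 ler_wpM2r ?invr_ge0// -addrA addrCA lerDl addr_ge0.
have xyj : n%:R ^+ p / 2 <= enorm (x - y).
  apply: le_trans (coord_le_enorm _ j); rewrite !mxE.
  have := lerB_dist (x ord0 j) (y ord0 j); apply: le_trans.
  move: xj yj; lra.
have Kxy : K (b^-1 *: (x - y)) <= CK * (A1 * n%:R ^- 3).
  apply: (@le_trans _ _ (CK * (n%:R ^+ p / 2) `^ (- rK))); last by rewrite ler_pM2l.
  apply: HK => //; apply: le_trans xyj _.
  by rewrite enormZ ger0_norm ?invr_ge0 ?(ltW b0)// ler_peMl ?enorm_ge0// invf_ge1.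
apply: (@le_trans _ _ (c1 * n%:R * (CK * (A1 * n%:R ^- 3) * n%:R))).
  apply: ler_pM => //; first exact: ratio_ge0.
    have e1 : 0 < (1 : R) <= 1 by rewrite ltr01 lexx.
    apply: le_trans (ratio_le w y e1 c10 H1 n0 kn) _.
    by rewrite subrr powRr0 mulr1 ler_pM2l.
  rewrite /scaled_kernel; apply: ler_pM => //; last by rewrite invr_ge0 exprn_ge0// ltW.
  by have [_ K0 _] := K_dens.
rewrite (_ : _ * _ = D3 * (n%:R * n%:R * n%:R ^- 3)); last by rewrite /D3; ring.
by rewrite nn3 ler_wpM2r ?invr_ge0// lerDr addr_ge0.
Qed.

Variable U : R.
Hypothesis f_max : forall x, f x <= U.
Hypothesis Cb_ge0 : 0 <= Cb.

Let smooth (b : R) x := fine (\int[lebesgue_rV d]_y (f y * scaled_kernel K b (x - y))%:E).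

(** No probability is involved: for a fixed path, control of the total weight and of the sums at
    grid points implies control of the estimate everywhere. The error [s] is kept abstract because
    the two passes use different ones. *)
Lemma path_bound : exists p0 : nat, forall (p : nat) (C1 : R), (p0 <= p)%N -> 0 <= C1 ->
  exists2 C : R, 0 <= C & forall n w (s : R),
    (0 < n)%N -> h n <= 1 -> (lambda n)^-1 <= n%:R -> (h n ^+ d)^-1 <= n%:R ->
    (h n)^-1 <= n%:R -> n%:R^-1 <= s -> C1 * s <= 2^-1 ->
    `|weighted_sum (cst 1) n w - n%:R| <= n%:R * (C1 * s) ->
    (forall t : @grid_index d n p,
       `|weighted_sum (fun y => scaled_kernel K (h n) (grid_point t - y)) n w -
         n%:R * smooth (h n) (grid_point t)| <= n%:R * (C1 * s)) ->
    forall x, `|wkde X q f K h n w x - f x| <= C * (s + h n ^+ 2).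
Proof.
have e1 : 0 < (1 : R) <= 1 by rewrite ltr01 lexx.
have [c1 c10 H1] := f_pow e1.
have [p1 [Cf Cf0 Hf]] := far_bound.
(* The Lipschitz constant is at most [Lip n^2] and the weights at most [c1 n], so a mesh [n^-4]
   leaves [1 / n <= s]. *)
exists (p1 + 4)%N => p C1 pp C10.
pose E1 := c1 * Lip * d%:R + Lip * d%:R.
have E10 : 0 <= E1 by rewrite addr_ge0 ?mulr_ge0 ?(ltW c10).
pose C3 := E1 + C1 + Cb + 2 * Cf.
have C30 : 0 <= C3 by rewrite /C3 addr_ge0 ?mulr_ge0// addr_ge0// addr_ge0.
have [C3a C3b C3c] : [/\ E1 + C1 <= C3, Cb <= C3 & 2 * Cf <= C3].
  by rewrite /C3; move: {C3 C30} E1 E10 Cb_ge0 => E1 E10 ?; split; lra.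
have U0 : 0 <= U by apply: le_trans (f_max 0); exact: f_ge0.
exists (2 * (C3 + U * C1)); first by apply: mulr_ge0 => //; apply: addr_ge0 => //;
    exact: mulr_ge0.
move=> n w s n0 h1 ln hdn hn ns C1s G1 Gt.
have N0 : 0 < n%:R :> R by rewrite ltr0n.
have N1 : 1 <= n%:R :> R by rewrite ler1n.
have h0 := h_gt0 n0.
have s0 : 0 <= s by apply: le_trans ns; rewrite invr_ge0.
have h20 : 0 <= h n ^+ 2 by rewrite sqr_ge0.
have rk k : (k < n)%N -> f (X k.+1 w) / q k w (X k.+1 w) <= c1 * n%:R.
  move=> kn; apply: le_trans (ratio_le w (X k.+1 w) e1 c10 H1 n0 (ltnW kn)) _.
  by rewrite subrr powRr0 mulr1 ler_pM2l.
have key x : `|weighted_sum (fun y => scaled_kernel K (h n) (x - y)) n w - n%:R * f x|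
    <= n%:R * (C3 * (s + h n ^+ 2)).
  have [/forallP xbox|] := boolP [forall j, `|x ord0 j| <= n%:R ^+ p]; last first.
    rewrite negb_forall => /existsP[j]; rewrite -ltNge => xj.
    have p1p : (p1 <= p)%N by apply: leq_trans pp; exact: leq_addr.
    have F k y : (k <= n)%N -> f x <=
        Cf / n%:R /\ f y / q k w y * scaled_kernel K (h n) (x - y) <= Cf / n%:R.
      by move=> kn; exact: (Hf p n k w x y (h n) j).
    have [fx _] := F 0%N 0 (leq0n _).
    have Gx : weighted_sum (fun y => scaled_kernel K (h n) (x - y)) n w <=
        n%:R * (Cf / n%:R).
      apply: (@le_trans _ _ (\sum_(k < n) (Cf / n%:R)));
          last by rewrite sumr_const card_ord mulr_natl.
      apply: ler_sum => k _.
      by have [_] := F k (X k.+1 w) (ltnW (ltn_ord k)).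
    have Gx0 : 0 <= weighted_sum (fun y => scaled_kernel K (h n) (x - y)) n w.
      apply: sumr_ge0 => k _; rewrite mulr_ge0 ?ratio_ge0//.
      by apply: scaled_kernel_ge0 => //; exact: ltW.
    apply: (@le_trans _ _ (n%:R * (2 * (Cf / n%:R)))).
      have nf0 : 0 <= n%:R * f x by rewrite mulr_ge0 ?f_ge0.
      have nfx : n%:R * f x <= n%:R * (Cf / n%:R) by rewrite ler_pM2l.
      rewrite ler_norml; apply/andP; split; lra.
    rewrite ler_pM2l//.
    apply: (@le_trans _ _ (2 * Cf * s)); first by rewrite -mulrA ler_pM2l// ler_wpM2l.
    apply: (@le_trans _ _ (C3 * s)); last by rewrite ler_wpM2l// lerDl.
    by rewrite ler_wpM2r.
  have [t tx] := grid_near n0 xbox.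
  have np0 : 0 <= n%:R ^- p :> R by rewrite invr_ge0 exprn_ge0.
  have xt : enorm (x - grid_point t) <= d%:R * n%:R ^- p by exact: enorm_le_coord.
  pose Lh := Lip / h n ^+ d.+1 * enorm (x - grid_point t).
  have LhE : Lh <= Lip * d%:R / n%:R / n%:R.
    apply: (@le_trans _ _ (Lip * (n%:R * n%:R) * (d%:R * n%:R ^- 4))).
      apply: ler_pM => //.
      - by rewrite divr_ge0// exprn_ge0// ltW.
      - exact: enorm_ge0.
      - rewrite ler_wpM2l// exprS invfM; apply: ler_pM => //.
          by rewrite invr_ge0 ltW.
        by rewrite invr_ge0 exprn_ge0// ltW.
      - apply: le_trans xt _; rewrite ler_wpM2l// lef_pV2 ?posrE ?exprn_gt0//.
        by apply: ler_weXn2l => //; apply: leq_trans pp; exact: leq_addl.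
    rewrite le_eqVlt; apply/orP; left; apply/eqP; rewrite !exprS expr0 mulr1; field.
    by rewrite gt_eqF.
  have Lh0 : 0 <= Lh.
    by rewrite /Lh mulr_ge0 ?enorm_ge0// divr_ge0// exprn_ge0// ltW.
  have Ga : `|weighted_sum (fun y => scaled_kernel K (h n) (x - y)) n w -
       weighted_sum (fun y => scaled_kernel K (h n) (grid_point t - y)) n w| <=
           n%:R * (c1 * n%:R * Lh).
    rewrite /weighted_sum -sumrB; apply: le_trans (ler_norm_sum _ _ _) _.
    apply: (@le_trans _ _ (\sum_(k < n) (c1 * n%:R * Lh)));
        last by rewrite sumr_const card_ord -[leLHS]mulr_natl.
    apply: ler_sum => k _; rewrite /increment -mulrBr normrM ger0_norm ?ratio_ge0//.
    apply: ler_pM => //; first exact: ratio_ge0.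
      exact: rk.
    apply: le_trans (scaled_kernel_lip K_lip _ _ h0) _.
    by rewrite /Lh opprB addrA subrK.
  have Gb := Gt t.
  have Gc : `|smooth (h n) (grid_point t) - smooth (h n) x| <= Lh.
    rewrite distrC; exact: (integral_scaled_kernel_lip K_dens K_max K_lip _ _ f_dens h0).
  have Gd := bias x h0.
  have cN : c1 * n%:R * Lh <= c1 * Lip * d%:R * s.
    apply: (@le_trans _ _ (c1 * n%:R * (Lip * d%:R / n%:R / n%:R))).
      by rewrite ler_wpM2l// mulr_ge0// ltW.
    rewrite (_ : _ * _ = c1 * Lip * d%:R * n%:R^-1); last by field; rewrite gt_eqF.
    by rewrite ler_wpM2l// !mulr_ge0// ltW.
  have LN : Lh <= Lip * d%:R * s.
    apply: le_trans LhE _; rewrite -mulrA ler_wpM2l// ?mulr_ge0//.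
    by apply: le_trans ns; rewrite ler_piMr ?invr_ge0// invf_le1.
  (* Mesh error of the sum, deviation at the grid point, mesh error of the smoothed density,
     bias. *)
  have -> : weighted_sum (fun y => scaled_kernel K (h n) (x - y)) n w - n%:R * f x =
    (weighted_sum (fun y => scaled_kernel K (h n) (x - y)) n w -
       weighted_sum (fun y => scaled_kernel K (h n) (grid_point t - y)) n w) +
    (weighted_sum (fun y => scaled_kernel K (h n) (grid_point t - y)) n w -
         n%:R * smooth (h n) (grid_point t)) +
    n%:R * (smooth (h n) (grid_point t) - smooth (h n) x) +
    n%:R * (smooth (h n) x - f x) by ring.
  apply: le_trans (ler_normD _ _) _; apply: le_trans (lerD (ler_normD _ _) (lexx _)) _.
  apply: le_trans (lerD (lerD (ler_normD _ _) (lexx _)) (lexx _)) _.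
  rewrite !normrM !(ger0_norm (ltW N0)).
  apply: (@le_trans _ _ (n%:R * (c1 * Lip * d%:R * s) + n%:R * (C1 * s) +
     n%:R * (Lip * d%:R * s) + n%:R * (Cb * h n ^+ 2))).
    apply: lerD; first apply: lerD; first apply: lerD => //.
    - by apply: le_trans Ga _; rewrite ler_wpM2l// ltW.
    - by rewrite ler_wpM2l// ?(ltW N0)//; exact: le_trans Gc LN.
    - by rewrite ler_wpM2l// ltW.
  rewrite -!mulrDr ler_wpM2l// ?(ltW N0)//.
  rewrite (_ : _ + _ = (E1 + C1) * s + Cb * h n ^+ 2); last by rewrite /E1; ring.
  rewrite mulrDr; apply: lerD.
    by rewrite ler_wpM2r.
  by rewrite ler_wpM2r.
move=> x; set S := weighted_sum (cst 1) n w.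
(* The assumption [C1 s <= 1/2] keeps the random denominator away from 0; this is the factor 2 in
   the final constant. *)
have S0 : n%:R / 2 <= S.
  move: G1; rewrite ler_norml => /andP[G1 _].
  have : n%:R * (C1 * s) <= n%:R / 2 by rewrite ler_pM2l.
  by move: G1; rewrite -/S; lra.
have Sp : 0 < S by apply: lt_le_trans S0; rewrite divr_gt0.
rewrite wkde_weighted_sum ?gt_eqF// -/S.
set G := weighted_sum _ n w.
have -> : G / S - f x = ((G - n%:R * f x) + f x * (n%:R - S)) / S by field; rewrite gt_eqF.
rewrite normrM normfV (ger0_norm (ltW Sp)) ler_pdivrMr//.
apply: (@le_trans _ _ (n%:R * (C3 * (s + h n ^+ 2)) + U * (n%:R * (C1 * s)))).
  apply: le_trans (ler_normD _ _) _; apply: lerD; first exact: key.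
  by rewrite normrM (ger0_norm (f_ge0 x)) distrC; apply: ler_pM => //; exact: f_ge0.
apply: (@le_trans _ _ (2 * (C3 + U * C1) * (s + h n ^+ 2) * (n%:R / 2))); last first.
  rewrite ler_wpM2l//; apply: mulr_ge0; last exact: addr_ge0.
  by apply: mulr_ge0 => //; apply: addr_ge0 => //; exact: mulr_ge0.
rewrite (_ : 2 * _ * _ * _ = n%:R * (C3 * (s + h n ^+ 2)) + U * (n%:R * (C1 * s)) +
    U * (n%:R * (C1 * h n ^+ 2))); last by field.
by rewrite lerDl; apply: mulr_ge0 => //; apply: mulr_ge0 => //; exact: mulr_ge0.
Qed.

Variable eps : R.
Hypothesis d_gt0 : (0 < d)%N.
Hypothesis eps_gt0 : 0 < eps.
Hypothesis rate_small : negligible_wrt (fun n => rate d h n + h n ^+ 4)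
                   (fun n => lambda n `^ (1 + eps)).
Hypothesis lambda_small : negligible_wrt (fun n => lambda n `^ (1 + eps)) (fun=> 1).

Lemma near_rate_le_lambda (c : R) : 0 < c ->
    \forall n \near \oo, rate d h n / lambda n <= c.
Proof.
move=> c0; have [N _ HN] := near_rate_le h_gt0 lambda_itv rate_small c0.
exists N.+1 => // n /= Nn; have n1 : (1 <= n)%N by apply: leq_ltn_trans Nn.
have /andP[l0 _] := lambda_itv n1.
rewrite ler_pdivrMr//; have [H _] := HN n (ltnW Nn).
by apply: le_trans H _; rewrite ler_pM2l//; exact: lambda_powR_le.
Qed.

(** * From a variance bound to a uniform rate *)

Section variance_to_rate.
Variables (u : 'rV[R]_d -> R) (Umax : R).
Hypotheses (mu : measurable_fun setT u) (u_itv : forall x, 0 <= u x <= Umax).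
Hypothesis u_int : (\int[lebesgue_rV d]_x (u x)%:E <= Umax%:E)%E.

(** [None] stands for the total weight and [Some t] for the kernel at a grid point, so one family
    controls numerator and denominator together. The absolute value makes [phi] nonnegative also for
    [n = 0], where the sign of [h] is unknown. *)
Let phi (p n : nat) (i : option (@grid_index d n p)) : 'rV[R]_d -> R :=
  if i is Some t then fun y => scaled_kernel K `|h n| (grid_point t - y) else cst 1.

Let mphi p n i : measurable_fun setT (@phi p n i).
Proof.
case: i => [t|]; last exact: measurable_cst.
exact: measurable_scaled_kernel.
Qed.

Let phi_ge0 p n i x : 0 <= @phi p n i x.
Proof. by case: i => [t|] //; exact: scaled_kernel_ge0. Qed.

Let B := 1 + Kmax + Umax * Kmax + Umax.

Let Umax_ge0 : 0 <= Umax.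
Proof. by have /andP[] := u_itv 0; exact: le_trans. Qed.

Let B_ge : [/\ 0 < B, 1 <= B, Kmax <= B, Umax * Kmax <= B & Umax <= B].
Proof.
have K0 := Kmax_ge0; have U0 := Umax_ge0; have UK : 0 <= Umax * Kmax by exact: mulr_ge0.
by rewrite /B; move: (Umax * Kmax) UK => z z0; split; lra.
Qed.

Let phi_bound p n i : (0 < n)%N -> h n <= 1 ->
  (forall x, @phi p n i x <= B / h n ^+ d) /\
  (\int[lebesgue_rV d]_x (u x * @phi p n i x ^+ 2)%:E <= (B / h n ^+ d)%:E)%E.
Proof.
move=> n0 h1; have h0 := h_gt0 n0; have [B0 B1 BK BUK BU] := B_ge.
have hd0 : 0 < h n ^+ d by rewrite exprn_gt0.
have hd1 : h n ^+ d <= 1 by rewrite exprn_ile1// ltW.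
have le_div c : 0 <= c -> c <= B -> c <= B / h n ^+ d.
  move=> c0 cB; rewrite ler_pdivlMr//; apply: le_trans cB.
  by rewrite ler_piMr.
case: i => [t|]; rewrite /phi; split.
- move=> x; rewrite (ger0_norm (ltW h0)).
  apply: le_trans (scaled_kernel_le K_max _ h0) _.
  by rewrite ler_pM2r ?invr_gt0.
- rewrite (ger0_norm (ltW h0)).
  apply: le_trans (integral_mul_scaled_kernel_sqr K_dens K_max _ mu u_itv h0) _.
  by rewrite lee_fin ler_pM2r ?invr_gt0.
- by move=> x; exact: le_div.
- under eq_integral do rewrite expr1n mulr1.
  by apply: le_trans u_int _; rewrite lee_fin le_div.
Qed.

(** The variance hypothesis stands inside the almost sure statement and may start at an index that
    depends on the path. Of the bounds on [rho], the lower one keeps [v n] large enough for the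
    exponential inequality, and the upper one makes [a_n sqrt(rho_n)] at most [a_n / lambda_n],
    which tends to 0. *)
Lemma rate_of_variance_bound (rho : nat -> R) (A : R) : 0 < A ->
  (forall n, (1 <= n)%N -> 1 <= rho n <= (lambda n)^-1) ->
  \forall w \ae P,
    (\forall n \near \oo, forall x,
      \sum_(k < n) f x * (f x / q k w x) <= n%:R * A * rho n * u x) ->
    exists C : R, \forall n \near \oo, forall x,
      `|wkde X q f K h n w x - f x| <= C * (rate d h n * Num.sqrt (rho n) + h n ^+ 2).
Proof.
move=> A0 rhoP.
have e1 : 0 < (1 : R) <= 1 by rewrite ltr01 lexx.
have [c1 c10 H1] := f_pow e1.
have [B0 B1 BK BUK BU] := B_ge.
have [p Hpath] := path_bound.
pose a := (2 * p * d)%N.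
pose kappa : R := 1 + (a + 3)%:R.
pose C1 : R := kappa * Num.sqrt (A * B).
have C10 : 0 <= C1 by rewrite mulr_ge0 ?sqrtr_ge0// addr_ge0.
have [C C0 HC] := Hpath p C1 (leqnn p) C10.
have [N1 _ Hreg] := near_regime d_gt0 h_gt0 lambda_itv eps_gt0 rate_small.
pose v n := n%:R * A * rho n * (B / h n ^+ d).
pose b n := c1 / lambda n * (B / h n ^+ d).
pose g n (i : option (@grid_index d n p)) := increment (phi i).
have ag n i : (forall k, measurable_fun [set: g_sigma_algebraType (history X k) * 'rV[R]_d]
     (fun z => g n i k z.1 z.2)) /\ (forall k w x, 0 <= g n i k w x).
  split=> *; first exact: measurable_increment.
  exact: increment_ge0.
have Icard : \forall n \near \oo, #|{: option (@grid_index d n p)}|%:R <=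
    ((3 ^ d).+1)%:R * n%:R ^+ a :> R.
  exists 1%N => // n /= n0; rewrite card_option -natrX -natrM ler_nat mulSn.
  rewrite -addn1 addnC leq_add//; first by rewrite expn_gt0 n0.
  exact: card_grid_index.
have gb : \forall n \near \oo, forall i k w x, (k < n)%N -> g n i k w x <= b n.
  exists (N1 + 1)%N => // n /= Nn i k w x kn.
  have n0 : (0 < n)%N by apply: leq_trans Nn; rewrite addn1.
  have [[_ _ h1] _ _] := Hreg n (leq_trans (leq_addr _ _) Nn).
  have [pb _] := @phi_bound p n i n0 h1.
  apply: ler_pM => //; first exact: ratio_ge0.
  have := ratio_le w x e1 c10 H1 n0 (ltnW kn).
  by rewrite subrr powRr0 mulr1.
have rho0 n : (1 <= n)%N -> 0 < rho n.
  by move=> /rhoP/andP[r1 _]; exact: lt_le_trans r1.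
have v0 n : (1 <= n)%N -> 0 < v n.
  move=> n0; rewrite /v !mulr_gt0 ?invr_gt0 ?exprn_gt0 ?ltr0n ?rho0//; exact: h_gt0.
(* The quantity to be bounded by 1/4 equals [(a_n / lambda_n) c1 sqrt(B / A) / sqrt(rho_n)], and
   [rho_n >= 1]. *)
pose delta := (4 * c1 * Num.sqrt (B / A))^-1.
have BA0 : 0 < B / A by exact: divr_gt0.
have delta0 : 0 < delta by rewrite invr_gt0 !mulr_gt0// sqrtr_gt0.
have [N2 _ Hd] := near_rate_le_lambda delta0.
have thb : \forall n \near \oo, Num.sqrt (ln n%:R / v n) * b n <= 4^-1.
  exists (N1 + N2 + 1)%N => // n /= Nn.
  have n0 : (0 < n)%N by apply: leq_trans Nn; rewrite addn1.
  have [[_ L1 h1] _ _] := Hreg n (leq_trans (leq_trans (leq_addr _ _) (leq_addr _ _)) Nn).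
  have rd := Hd n (leq_trans (leq_trans (leq_addl _ _) (leq_addr _ _)) Nn).
  have vn := v0 n n0; have h0 := h_gt0 n0; have /andP[l0 _] := lambda_itv n0.
  have hd0 : 0 < h n ^+ d by rewrite exprn_gt0.
  have L0 : 0 <= ln n%:R :> R by apply: le_trans L1.
  have N0 : 0 < n%:R :> R by rewrite ltr0n.
  have /andP[r1 _] := rhoP n n0; have r0 := rho0 n n0.
  have b0 : 0 <= b n by rewrite mulr_ge0// divr_ge0// ltW.
  suff : (Num.sqrt (ln n%:R / v n) * b n) ^+ 2 <= 4^-1 ^+ 2.
    by rewrite ler_pXn2r// nnegrE ?invr_ge0// mulr_ge0// sqrtr_ge0.
  rewrite exprMn sqr_sqrtr; last by rewrite divr_ge0// ltW.
  have a2 : rate d h n ^+ 2 = ln n%:R / (n%:R * h n ^+ d).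
    by rewrite sqr_sqrtr// divr_ge0// mulr_ge0// ltW.
  have -> : ln n%:R / v n * b n ^+ 2 =
      (rate d h n / lambda n) ^+ 2 * (c1 ^+ 2 * (B / A)) / rho n.
    rewrite [in RHS]exprMn a2 /v /b; field.
    by rewrite !gt_eqF.
  apply: (@le_trans _ _ (delta ^+ 2 * (c1 ^+ 2 * (B / A)))).
    rewrite ler_pdivrMr//.
    apply: (@le_trans _ _ (delta ^+ 2 * (c1 ^+ 2 * (B / A)))).
      rewrite ler_wpM2r//; first by rewrite mulr_ge0 ?sqr_ge0// ltW.
      by rewrite ler_pXn2r// nnegrE ?divr_ge0 ?rate_ge0 ?(ltW l0) ?(ltW delta0).
    rewrite ler_peMr// mulr_ge0 ?sqr_ge0// mulr_ge0 ?sqr_ge0// ltW//.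
  rewrite /delta exprVn !exprMn sqr_sqrtr ?(ltW BA0)// le_eqVlt; apply/orP; left; apply/eqP.
  by field; rewrite !gt_eqF.
(* Chosen so that [C1 a_n sqrt(rho_n) <= 1/2], as the pathwise lemma demands. *)
have delta1 : 0 < (2 * (C1 + 1))^-1 by rewrite invr_gt0 mulr_gt0// ltr_wpDl.
have [N3 _ Hd1] := near_rate_le_lambda delta1.
apply: filterS (ae_family_concentration polq ag Icard gb _ thb) =>
    [w [N4 _ Hdev] [N5 _ Hq]|]; last first.
  by exists 1%N => // n /= n1; exact: v0.
exists C; exists (N1 + N2 + N3 + N4 + N5 + 1)%N => // n /= Nn.
have n0 : (0 < n)%N by apply: leq_trans Nn; rewrite addn1.
have [n1 n2 n3 n4] : [/\ (N1 <= n)%N, (N3 <= n)%N, (N4 <= n)%N & (N5 <= n)%N].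
  by clear -Nn; split; lia.
have [[_ L1 h1] [_ _ na] [li hdn hn]] := Hreg n n1.
have h0 := h_gt0 n0; have /andP[l0 _] := lambda_itv n0.
have hd0 : 0 < h n ^+ d by rewrite exprn_gt0.
have L0 : 0 <= ln n%:R :> R by apply: le_trans L1.
have N0 : 0 < n%:R :> R by rewrite ltr0n.
have /andP[r1 rl] := rhoP n n0; have r0 := rho0 n n0.
have sr1 : 1 <= Num.sqrt (rho n) by rewrite -[leLHS]sqrtr1 ler_wsqrtr.
have srr : Num.sqrt (rho n) <= rho n.
  by rewrite -[leRHS]sqr_sqrtr ?(ltW r0)// expr2 ler_peMr// sqrtr_ge0.
have ra0 : 0 <= rate d h n by exact: rate_ge0.
have vL : (1 + (a + 3)%:R) * Num.sqrt (v n * ln n%:R) =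
    n%:R * (C1 * (rate d h n * Num.sqrt (rho n))).
  have -> : v n * ln n%:R = (n%:R * (Num.sqrt (A * B) * (rate d h n * Num.sqrt (rho
      n)))) ^+ 2.
    have a2 : rate d h n ^+ 2 = ln n%:R / (n%:R * h n ^+ d).
      by rewrite sqr_sqrtr// divr_ge0// mulr_ge0// ltW.
    have AB0 : 0 <= A * B by rewrite mulr_ge0// ltW.
    rewrite !exprMn a2 (sqr_sqrtr AB0) (sqr_sqrtr (ltW r0)) /v; field.
    by rewrite !gt_eqF.
  rewrite sqrtr_sqr ger0_norm; last by rewrite !mulr_ge0 ?sqrtr_ge0// ltW.
  by rewrite /C1 /kappa; ring.
have dev i : `|deviation X q (g n i) n w| <= n%:R * (C1 * (rate d h n * Num.sqrt (rho n))).
  rewrite -vL; apply: Hdev => //.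
  have [_ pi] := @phi_bound p n i n0 h1.
  have u0 x : 0 <= u x by have /andP[] := u_itv x.
  have c0 : 0 <= n%:R * A * rho n by rewrite !mulr_ge0// ltW.
  exact: (quad_var_increment_le (@mphi p n i) mu u0 c0 (Hq n n4) pi).
have C1s : C1 * (rate d h n * Num.sqrt (rho n)) <= 2^-1.
  apply: (@le_trans _ _ ((C1 + 1) * (2 * (C1 + 1))^-1)).
    apply: ler_pM => //; first by rewrite mulr_ge0 ?sqrtr_ge0.
      by rewrite lerDl.
    apply: le_trans (Hd1 n n2); rewrite ler_wpM2l//.
    exact: le_trans srr rl.
  have C11 : 0 < C1 + 1 by rewrite ltr_wpDl.
  by rewrite invfM mulrCA mulfV ?gt_eqF// mulr1.
have ms : n%:R^-1 <= rate d h n * Num.sqrt (rho n).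
  by apply: le_trans na _; rewrite ler_peMr.
apply: (HC n w _ n0 h1 li hdn hn ms C1s).
- have := dev None; rewrite deviation_increment.
  under eq_integral do rewrite mulr1.
  by have [_ _ ->] := f_dens; rewrite mulr1.
- move=> t; have := dev (Some t); rewrite deviation_increment//.
  by rewrite /phi (ger0_norm (ltW h0)).
Qed.
End variance_to_rate.

(** With this exponent, [f <= tau] means [f^(2 e) <= lambda]. Then [ratio_le] with [eta = 1 - e]
    bounds [f^2 / q] by [(c / lambda) f^(2 e) f^(1 - e)], where [lambda] cancels exactly. *)
Let e := (1 + eps)^-1.
Let tau n := Num.sqrt (lambda n `^ (1 + eps)).

Let e_itv : 0 < e < 1.
Proof.
have e1 : 1 < 1 + eps by rewrite ltrDl.
by rewrite invr_gt0 (lt_trans ltr01 e1)/= invf_lt1// (lt_trans ltr01 e1).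
Qed.

Let eta_itv : 0 < 1 - e <= 1.
Proof. by have /andP[e0 e1] := e_itv; rewrite subr_gt0 e1/= gerBl ltW. Qed.

Lemma good_ratio_le (ce : R) k w x : 0 < ce -> (forall x, f x `^ (1 - e) <= ce * q0 x) ->
  (1 <= k)%N -> lambda k <= 2^-1 -> `|wkde X q f K h k w x - f x| <= tau k / 2 ->
  f x * (f x / q k w x) <= (4 + ce) * (f x + f x `^ (1 - e)).
Proof.
move=> ce0 Hce k0 lk Hk.
have /andP[l0 _] := lambda_itv k0.
have /andP[e0 e1] := e_itv.
have p0 : 0 <= f x `^ (1 - e) by exact: powR_ge0.
have := f_ge0 x; rewrite le_eqVlt => /predU1P[fx0|fx0].
  by rewrite -{1}fx0 mul0r mulr_ge0// addr_ge0// ?f_ge0// ltW.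
have [tf|ft] := leP (tau k) (f x).
  (* One factor 1/2 is [1 - lambda k], the other comes from [f_k >= f - tau / 2 >= f / 2]. *)
  have qf : f x / 4 <= q k w x.
    rewrite q_mixture//.
    apply: (@le_trans _ _ ((1 - lambda k) * wkde X q f K h k w x)); last first.
      by rewrite lerDl mulr_ge0 ?q0_ge0// ltW.
    have wf : f x / 2 <= wkde X q f K h k w x.
      by move: Hk; rewrite ler_norml => /andP[Hk _]; lra.
    apply: (@le_trans _ _ (2^-1 * (f x / 2))); first by lra.
    apply: ler_pM => //; lra.
  have qp : 0 < q k w x by apply: lt_le_trans qf; rewrite divr_gt0.
  rewrite mulrA ler_pdivrMr//.
  apply: (@le_trans _ _ (4 * f x * q k w x)).
    rewrite (_ : f x * f x = 4 * f x * (f x / 4)); last by field.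
    by rewrite ler_wpM2l// mulr_ge0// ltW.
  rewrite ler_wpM2r ?(ltW qp)//; apply: ler_pM; rewrite ?(ltW fx0)// ?lerDl//; exact: ltW.
have fe : f x `^ 2 `^ e <= lambda k.
  have -> : lambda k = lambda k `^ (1 + eps) `^ e.
    by rewrite -powRrM mulfV ?powRr1 ?(ltW l0)// gt_eqF// addr_gt0.
  apply: ge0_ler_powR; rewrite ?nnegrE ?powR_ge0 ?(ltW e0)//.
  rewrite -[leRHS]sqr_sqrtr ?powR_ge0// -/(tau k) powR_mulrn ?(ltW fx0)//.
  by rewrite ler_pXn2r ?nnegrE ?sqrtr_ge0 ?(ltW ft) ?(ltW fx0).
apply: (@le_trans _ _ (f x * (ce / lambda k * f x `^ (1 - (1 - e))))).
  rewrite ler_pM2l//; exact: (ratio_le w x eta_itv ce0 Hce k0 (leqnn k)).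
rewrite subKr.
have -> : f x * (ce / lambda k * f x `^ e) =
    ce / lambda k * (f x `^ 2 `^ e * f x `^ (1 - e)).
  have -> : f x `^ 2 `^ e = f x `^ e * f x `^ e.
    by rewrite -powRrM mulrC mulr_natr mulr2n powRD//; apply/implyP => _; exact: lt0r_neq0.
  have -> : f x * (ce / lambda k * f x `^ e) = ce / lambda k * (f x `^ e * f x) by ring.
  congr (_ * _); rewrite -mulrA; congr (_ * _).
  rewrite -powRD; last by apply/implyP => _; exact: lt0r_neq0.
  by rewrite addrC subrK powRr1 ?(ltW fx0).
apply: (@le_trans _ _ (ce / lambda k * (lambda k * f x `^ (1 - e)))).
  by rewrite ler_wpM2l ?divr_ge0 ?(ltW ce0) ?(ltW l0)// ler_wpM2r.
rewrite mulrA divfK ?gt_eqF//; apply: ler_pM => //; first exact: ltW.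
  by rewrite lerDr.
by rewrite lerDr ltW.
Qed.

Lemma sum_indicator_le (D : R) (k0 n : nat) : 0 <= D ->
  \sum_(k < n) (if (k < k0)%N then D else 0) <= k0%:R * D.
Proof.
move=> D0; suff -> : \sum_(k < n) (if (k < k0)%N then D else 0) = (minn n k0)%:R * D.
  by rewrite ler_wpM2r// ler_nat geq_minr.
elim: n => [|n IH]; first by rewrite big_ord0 min0n mul0r.
rewrite big_ord_recr/= IH; case: ifPn => nk; last rewrite -leqNgt in nk.
  by rewrite (minn_idPl (ltnW nk)) (minn_idPl nk) -natr1 mulrDl mul1r.
by rewrite addr0 (minn_idPr nk) (minn_idPr (leqW nk)).
Qed.

Lemma uniform_rate : \forall w \ae P, exists C : R, \forall n \near \oo, forall x,
  `|wkde X q f K h n w x - f x| <= C * (rate d h n + h n ^+ 2).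
Proof.
have e1 : 0 < (1 : R) <= 1 by rewrite ltr01 lexx.
have [c1 c10 H1] := f_pow e1.
have [ce ce0 Hce] := f_pow eta_itv.
have [Q Q0 HQ] := polynomial_decay_bounded q0_decay.
have [mf f0 f1] := f_dens; have [mq0 _ q01] := q0_dens.
pose u x := f x + f x `^ (1 - e).
have p0 x : 0 <= f x `^ (1 - e) by exact: powR_ge0.
have mp : measurable_fun setT (fun x => f x `^ (1 - e)).
  exact: (measurableT_comp (measurable_powR (1 - e))).
have mu : measurable_fun setT u by exact: measurable_funD.
(* Both the supremum and the integral of [u] are covered: [f^(1 - e) <= ce q0], where [q0] is
   bounded and has integral 1. *)
pose Um := U + ce * Q + (1 + ce).
have U0 : 0 <= U by apply: le_trans (f_max 0); exact: f_ge0.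
have u_itv x : 0 <= u x <= Um.
  rewrite addr_ge0//=; apply: (@le_trans _ _ (U + ce * Q)).
    by apply: lerD => //; apply: le_trans (Hce x) _; rewrite ler_pM2l.
  by rewrite lerDl addr_ge0// ltW.
have u_int : (\int[lebesgue_rV d]_x (u x)%:E <= Um%:E)%E.
  under eq_integral do rewrite EFinD.
  rewrite ge0_integralD//; last 4 first.
  - by move=> x _; rewrite lee_fin.
  - exact/measurable_EFinP.
  - by move=> x _; rewrite lee_fin.
  - exact/measurable_EFinP.
  rewrite f1; apply: (@le_trans _ _ (1 + ce%:E)%E).
    rewrite leeD2l//.
    apply: (@le_trans _ _ (\int[lebesgue_rV d]_x (ce%:E * (q0 x)%:E))%E).
      apply: ge0_le_integral => //.
      - by move=> x _; rewrite lee_fin.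
      - exact/measurable_EFinP.
      - by apply: emeasurable_funM => //; exact/measurable_EFinP.
      - by move=> x _; rewrite -EFinM lee_fin.
    rewrite ge0_integralZl// ?q01 ?mule1//.
    - exact/measurable_EFinP.
    - by move=> x _; rewrite lee_fin q0_ge0.
    - by rewrite lee_fin ltW.
  by rewrite -EFinD lee_fin lerDr addr_ge0// mulr_ge0// ltW.
have r1 n : (1 <= n)%N -> 1 <= (lambda n)^-1 <= (lambda n)^-1.
  by move=> /lambda_itv/andP[l0 l1]; rewrite lexx andbT invf_ge1.
have r2 n : (1 <= n)%N -> 1 <= (1 : R) <= (lambda n)^-1.
  by move=> /r1/andP[r _]; rewrite lexx.
(* One [4 + ce] pays for the steps with a good ratio, the other absorbs the finitely many early
   steps once [n] is large. *)
have A0 : 0 < 2 * (4 + ce) by rewrite mulr_gt0// addr_gt0.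
have crude k n w x : (1 <= n)%N -> (k <= n)%N ->
    f x * (f x / q k w x) <= c1 / lambda n * u x.
  move=> n1 kn; have /andP[l0 _] := lambda_itv n1.
  have H := ratio_le w x e1 c10 H1 n1 kn.
  rewrite subrr powRr0 mulr1 in H.
  apply: (@le_trans _ _ (f x * (c1 / lambda n))); first by rewrite ler_wpM2l.
  rewrite mulrC ler_wpM2l ?divr_ge0 ?(ltW c10) ?(ltW l0)//.
  by rewrite lerDl.
have R1 := rate_of_variance_bound mu u_itv u_int c10 r1.
have R2 := rate_of_variance_bound mu u_itv u_int A0 r2.
apply: filterS2 R1 R2 => w R1 R2.
case: R1 => [|C1 HC1].
  exists 1%N => // n /= n1 x.
  apply: (@le_trans _ _ (\sum_(k < n) (c1 / lambda n * u x))).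
    by apply: ler_sum => k _; apply: crude => //; exact: ltnW.
  by rewrite sumr_const card_ord -[leLHS]mulr_natl !mulrA.
(* The first pass reaches the precision that the second needs: [a_n <= c tau^2] and
   [tau <= sqrt(lambda)] give [a_n / sqrt(lambda) <= c tau], while [h^4 <= c^2 tau^2] gives
   [h^2 <= c tau]. The constant [c] makes the total [tau / 2]. *)
have D1 : \forall n \near \oo, lambda n <=
    2^-1 /\ forall x, `|wkde X q f K h n w x - f x| <= tau n / 2.
  pose c := (4 * (`|C1| + 1))^-1.
  have C10 : 0 < `|C1| + 1 by rewrite ltr_wpDl.
  have c0 : 0 < c by rewrite invr_gt0 mulr_gt0.
  have [N1 _ Hr] := near_rate_le h_gt0 lambda_itv rate_small c0.
  have [N2 _ Hh] := near_rate_le h_gt0 lambda_itv rate_small (exprn_gt0 2 c0).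
  have h20 : 0 < (2^-1 : R) by rewrite invr_gt0.
  have [N3 _ Hl] := near_lambda_le lambda_itv eps_gt0 lambda_small h20.
  have [N4 _ HC] := HC1.
  exists (N1 + N2 + N3 + N4 + 1)%N => // n /= Nn.
  have [n1 n2 n3 n4 n5] : [/\ (N1 <= n)%N, (N2 <= n)%N, (N3 <= n)%N, (N4 <=
      n)%N & (1 <= n)%N].
    by clear -Nn; split; lia.
  split; first exact: Hl.
  move=> x; apply: le_trans (HC n n4 x) _.
  have /andP[l0 l1] := lambda_itv n5.
  have [ra _] := Hr n n1; have [_ hh] := Hh n n2.
  have t0 : 0 <= tau n by exact: sqrtr_ge0.
  have t2 : tau n ^+ 2 = lambda n `^ (1 + eps) by rewrite sqr_sqrtr// powR_ge0.
  have tl : tau n <= Num.sqrt (lambda n).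
    by apply: ler_wsqrtr; exact: lambda_powR_le.
  have h2 : h n ^+ 2 <= c * tau n.
    rewrite -(@ler_pXn2r _ 2)// ?nnegrE ?sqr_ge0 ?mulr_ge0 ?(ltW c0)//.
    by rewrite -exprM exprMn t2.
  have rs : rate d h n * Num.sqrt (lambda n)^-1 <= c * tau n.
    apply: (@le_trans _ _ (c * lambda n `^ (1 + eps) * Num.sqrt (lambda n)^-1)).
      by rewrite ler_wpM2r ?sqrtr_ge0.
    rewrite -t2 expr2 -!mulrA ler_pM2l// ler_piMr//.
    apply: (@le_trans _ _ (Num.sqrt (lambda n) * Num.sqrt (lambda n)^-1)).
      by rewrite ler_wpM2r ?sqrtr_ge0.
    by rewrite -sqrtrM ?(ltW l0)// mulfV ?gt_eqF// sqrtr1.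
  apply: (@le_trans _ _ ((`|C1| + 1) * (c * tau n + c * tau n))).
    have s0 : 0 <= rate d h n * Num.sqrt (lambda n)^-1 + h n ^+ 2.
      by rewrite addr_ge0 ?sqr_ge0// mulr_ge0 ?sqrtr_ge0.
    apply: (@le_trans _ _ ((`|C1| + 1) * (rate d h n * Num.sqrt (lambda n)^-1 + h n ^+ 2))).
      by rewrite ler_wpM2r//; apply: le_trans (ler_norm _) _; rewrite lerDl.
    by rewrite ler_wpM2l ?(ltW C10)// lerD.
  rewrite le_eqVlt; apply/orP; left; apply/eqP; rewrite /c; field.
  by rewrite gt_eqF.
case: R2 => [|C2 HC2]; last first.
  exists C2; apply: filterS HC2 => n H x; have := H x.
  by rewrite sqrtr1 mulr1.
have [k0 _ Hk0] := D1.
(* The successor ensures [k >= 1] beyond this index, where the mixture formula holds. *)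
pose k1 := k0.+1.
have k1P k : (k1 <= k)%N -> forall x, f x * (f x / q k w x) <= (4 + ce) * u x.
  move=> k1k x; have [lk Hk] := Hk0 k (ltnW k1k).
  by apply: good_ratio_le => //; apply: leq_trans k1k.
have /andP[lk0 _] := @lambda_itv k1 isT.
pose D := c1 / lambda k1.
have D0 : 0 <= D by rewrite divr_ge0// ltW.
exists (Num.truncn (k1%:R * D / (4 + ce))).+1 => // n /= Nn x.
have u0 : 0 <= u x by have /andP[] := u_itv x.
have ce4 : 0 < 4 + ce by rewrite addr_gt0.
have nD : k1%:R * D <= n%:R * (4 + ce).
  rewrite -ler_pdivrMr//; apply: ltW; apply: lt_le_trans (truncnS_gt _) _.
  by rewrite ler_nat.
apply: (@le_trans _ _ (\sum_(k < n) ((4 + ce) * u x +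
    (if (k < k1)%N then D else 0) * u x))).
  apply: ler_sum => k _; case: ltnP => kk.
    apply: le_trans (crude k k1 w x isT (ltnW kk)) _.
    by rewrite lerDr mulr_ge0// ltW.
  by rewrite mul0r addr0 k1P.
rewrite big_split/= sumr_const card_ord -mulr_suml.
apply: (@le_trans _ _ (n%:R * (4 + ce) * u x + k1%:R * D * u x)).
  apply: lerD; first by rewrite -[leLHS]mulr_natl mulrA.
  by rewrite ler_wpM2r// sum_indicator_le.
apply: (@le_trans _ _ (n%:R * (4 + ce) * u x + n%:R * (4 + ce) * u x)).
  by rewrite lerD2l ler_wpM2r.
by rewrite le_eqVlt; apply/orP; left; apply/eqP; ring.
Qed.

End mixture_policy.

(** * Invariance under scaling of the target *)

Section normalized_weights.
Context {R : realType} {d : nat} {dO : measure_display}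
  {Omega : measurableType dO} {P : probability Omega R}.
Variable X : nat -> {RV P >-> 'rV[R]_d}.
Variable q : nat -> Omega -> 'rV[R]_d -> R.
Variables (fU K : 'rV[R]_d -> R) (h : nat -> R).
Hypothesis fU_int : (0 < \int[lebesgue_rV d]_x (fU x)%:E < +oo)%E.

(** The unknown constant divides every weight and cancels in the normalized ones; the test for a
    zero sum is also unaffected by it. So the analysis may be carried out with the exact density. *)
Lemma wkde_normalize n w x :
  wkde X q fU K h n w x = wkde X q (normalize fU) K h n w x.
Proof.
set I := fine (\int[lebesgue_rV d]_x (fU x)%:E)%E.
have I0 : 0 < I by exact: fine_gt0.
have wE k : weight X q (normalize fU) k w = weight X q fU k w / I.
  by rewrite /weight /normalize -/I mulrAC.
apply: eq_bigr => k _; congr (_ * _); rewrite /nweight.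
under [in RHS]eq_bigr do rewrite wE.
rewrite -mulr_suml wE mulf_eq0 invr_eq0 (gt_eqF I0) orbF.
case: ifPn => // S0; field; rewrite S0 gt_eqF//.
Qed.

End normalized_weights.

Theorem theorem7 (R : realType) (d : nat) (d_gt0 : (0 < d)%N)
  (dO : measure_display) (Omega : measurableType dO) (P : probability Omega R)
  (fU : 'rV[R]_d -> R)
  (fU_meas : measurable_fun setT fU)
  (fU_ge0 : forall x, 0 <= fU x)
  (fU_int : (0 < \int[lebesgue_rV d]_x (fU x)%:E < +oo)%E)
  (q0 K : 'rV[R]_d -> R) (h lambda : nat -> R)
  (H1 : target_hyp (normalize fU))
  (H2 : safe_density_hyp (normalize fU) q0)
  (H3 : kernel_hyp K)
  (h_gt0 : forall k, (1 <= k)%N -> 0 < h k)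
  (h_bounded : exists M : R, forall k, (1 <= k)%N -> h k <= M)
  (lambda_itv : forall k, (1 <= k)%N -> 0 < lambda k <= 1)
  (lambda_nincr : forall j k, (1 <= j)%N -> (j <= k)%N -> lambda k <= lambda j)
  (X : nat -> {RV P >-> 'rV[R]_d}) (q : nat -> Omega -> 'rV[R]_d -> R)
  (q_policy : is_policy X q)
  (q_0 : forall w, q 0%N w = q0)
  (q_mixture : forall k w x, (1 <= k)%N ->
    q k w x = (1 - lambda k) * wkde X q fU K h k w x + lambda k * q0 x)
  (rates : exists2 eps : R, 0 < eps &
    negligible_wrt (fun n => rate d h n + h n ^+ 4)
                   (fun n => lambda n `^ (1 + eps)) /\
    negligible_wrt (fun n => lambda n `^ (1 + eps)) (fun=> 1)) :
  \forall w \ae P, exists C : R, \forall n \near \oo,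
    (ereal_sup [set `|wkde X q fU K h n w x - normalize fU x|%:E
               | x in [set: 'rV[R]_d]]
     <= (C * (rate d h n + h n ^+ 2))%:E)%E.
Proof.
have [f_dens C2f hess_f] := H1.
have [q0_dens f_pow q0_decay] := H2.
have [K_dens [L K_lip] K_mean K_var K_decay] := H3.
have [eps eps_gt0 [rate_small lambda_small]] := rates.
have [Kmax _ K_max] := polynomial_decay_bounded K_decay.
have [Q _ q0_max] := polynomial_decay_bounded q0_decay.
have e1 : 0 < (1 : R) <= 1 by rewrite ltr01 lexx.
have [c c0 f_le] := f_pow 1 e1.
(* Boundedness of the target is not assumed: it follows from domination by the bounded density [q0],
   with exponent 1. *)
have f_max x : normalize fU x <= c * Q.
  have [_ f0 _] := f_dens; have := f_le x; rewrite powRr1// => /le_trans; apply.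
  by rewrite ler_pM2l.
have [Cb Cb_ge0 bias] : exists2 C : R, 0 <= C & forall (b : R) x, 0 < b ->
    `|fine (\int[lebesgue_rV d]_y (normalize fU y * scaled_kernel K b (x - y))%:E) -
      normalize fU x| <= C * b ^+ 2.
  by apply: kernel_bias => //; exists (c * Q).
have K_lip' x y : `|K x - K y| <= `|L| * enorm (x - y).
  by apply: le_trans (K_lip x y) _; rewrite ler_wpM2r ?enorm_ge0 ?ler_norm.
have q_mixture' k w x : (1 <= k)%N ->
    q k w x = (1 - lambda k) * wkde X q (normalize fU) K h k w x + lambda k * q0 x.
  by move=> k1; rewrite q_mixture// wkde_normalize.
apply: filterS (uniform_rate q_policy f_dens q0_dens K_dens f_pow h_gt0 lambda_itv
  lambda_nincr q_0 q_mixture' K_max K_lip' _ K_decay q0_decay bias f_max Cb_ge0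
  d_gt0 eps_gt0 rate_small lambda_small) => // w [C HC].
exists C; apply: filterS HC => n HC.
apply: ge_ereal_sup => _ [x _ <-].
by rewrite lee_fin wkde_normalize.
Qed.
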